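(* Let $G$ be a graph and let $S \subseteq V_G$ be a cycle cover of $G$. Let $H$ be a graph obtained by attaching a non-pure star complete graph to each vertex in $S$. Then, for all $k \ge 1$, the graph $H_k = H(k, \dots, k)$ is vertex decomposable. In particular, $J(H)^{(k)}$ is Koszul for all $k \ge 1$.
   Context: All graphs are finite, simple and undirected; $V_G$ and $E_G$ denote the vertex set and edge set of $G$. A subset $S \subseteq V_G$ is a cycle cover of $G$ if the induced subgraph $G \setminus S$ on $V_G\setminus S$ has no cycle. A star complete graph is a graph obtained by joining complete graphs (each on at least 2 vertices) at a common vertex. It is pure if all of its maximal cliques contain at least 3 vertices (i.e. it has no whiskers); otherwise it is non-pure (i.e. at least one of the joined complete graphs is a single edge). Attaching a star complete graph to a vertex $x$ of $G$ means taking a disjoint copy of the star complete graph and identifying its common vertex with $x$; different vertices of $S$ may receive different star complete graphs. Duplication: let $\Gamma$ be a graph with vertices $x_1,\dots,x_n$ and edges $e_1,\dots,e_m$. For an edge $e=\{x_i,x_j\}$ and an integer $r \ge 0$, set $V(e(r)) = \{x_{t,p} \mid t \in \{i,j\},\ 1\le p\le r\}$ and $E(e(r)) = \{\{x_{i,p},x_{j,q}\} \mid p,q\ge 1,\ p+q\le r+1\}$. For $(k_1,\dots,k_m)\in \mathbb Z_{\ge 0}^m$, $\Gamma(k_1,\dots,k_m)$ is the graph with vertex set $\bigcup_{i=1}^m V(e_i(k_i))$ and edge set $\bigcup_{i=1}^m E(e_i(k_i))$. $\Gamma_k$ denotes $\Gamma(k,\dots,k)$. For a vertex $x$ of a graph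 $\Gamma$, $N_\Gamma[x] = \{x\}\cup\{y \mid \{x,y\}\in E_\Gamma\}$; for $U \subseteq V_\Gamma$, $\Gamma\setminus U$ is the induced subgraph on $V_\Gamma \setminus U$. A graph $\Gamma$ is vertex decomposable if either $\Gamma$ consists of isolated vertices (no edges), or there is a vertex $x$ such that (1) no independent set in $\Gamma\setminus N_\Gamma[x]$ is a maximal independent set in $\Gamma\setminus x$, and (2) both $\Gamma\setminus x$ and $\Gamma\setminus N_\Gamma[x]$ are vertex decomposable. Let $\Bbbk$ be an infinite field. The vertices of $H$ are identified with the variables of a polynomial ring $R$ over $\Bbbk$. The cover ideal of $H$ is $J(H) = \langle x_{i_1}\cdots x_{i_r} \mid \{x_{i_1},\dots,x_{i_r}\} \text{ is a vertex cover of } H\rangle \subseteq R$, where a vertex cover is a set of vertices meeting every edge. For an ideal $I \subseteq R$, $I^{(k)} = \bigcap_{\mathfrak p \in \operatorname{Ass}(R/I)} (I^k R_{\mathfrak p} \cap R)$. Let $\mathfrak m$ be the homogeneous maximal ideal of $R$. An ideal $I$ (more generally a finitely generated $R$-module $M$) is Koszul if $\operatorname{gr}_{\mathfrak m}(M) = \bigoplus_{i\ge 0} \mathfrak m^i M/\mathfrak m^{i+1}M$ (with $M=I$) has a linear resolution over $\operatorname{gr}_{\mathfrak m}(R) = \bigoplus_{i \ge 0} \mathfrak m^i/\mathfrak m^{i+1}$. (It is known that a homogeneous ideal of $R$ is Koszul if and only if it is componentwise linear.) *)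

(* Defs.v *)
From HB Require Import structures.
From mathcomp Require Import mpoly.
From mathcomp Require Import all_boot all_order all_algebra generic_quotient ring_quotient.
From mathcomp Require Import boolp.
From mathcomp Require Import ring.

Set Implicit Arguments.
Unset Strict Implicit.
Unset Printing Implicit Defensive.

Import GRing.Theory.

(** * Finite simple graphs *)

Record sgraph := SGraph {
  svertex :> finType;
  sedge : rel svertex;
  sedge_sym : symmetric sedge;
  sedge_irrefl : irreflexive sedge }.

Notation "x -- y" := (sedge x y) (at level 30, no associativity).

Section Graph.
Variable G : sgraph.
Implicit Types (x y : G) (A B U : {set G}).

Lemma induced_sym A : symmetric (fun u v : {x : G | x \in A} => val u -- val v).
Proof. by move=> u v; rewrite sedge_sym. Qed.

Lemma induced_irrefl A :
  irreflexive (fun u v : {x : G | x \in A} => val u -- val v).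
Proof. by move=> u; rewrite sedge_irrefl. Qed.

Definition induced A : sgraph := SGraph (@induced_sym A) (@induced_irrefl A).

Definition del U : sgraph := induced (~: U).

Definition closed_nbh x : {set G} := [set y | (y == x) || (x -- y)].

(* Simple graphs have no loops or double edges, so a cycle has length >= 3. *)
Definition has_no_cycle : Prop :=
  forall p : seq G, ucycle (@sedge G) p -> size p < 3.

Definition indep A : bool := [forall x in A, forall y in A, ~~ (x -- y)].

Definition clique A : bool :=
  [forall x in A, forall y in A, (x != y) ==> (x -- y)].

Definition vertex_cover A : bool :=
  [forall x, forall y, (x -- y) ==> (x \in A) || (y \in A)].

(* Maximal independent sets of the induced subgraph on B, as subsets of G. *)
Definition max_indep_in B A : bool :=
  maxset (fun C : {set G} => (C \subset B) && indep C) A.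

Definition shedding x : Prop :=
  forall A, A \subset ~: closed_nbh x -> indep A ->
    ~~ max_indep_in (~: [set x]) A.

End Graph.

Definition cycle_cover (G : sgraph) (S : {set G}) : Prop :=
  has_no_cycle (del S).

Inductive vertex_decomposable (G : sgraph) : Prop :=
| vd_isolated : (forall x y : G, ~~ (x -- y)) -> vertex_decomposable G
| vd_shed (x : G) : shedding x ->
    vertex_decomposable (del [set x]) ->
    vertex_decomposable (del (closed_nbh x)) -> vertex_decomposable G.

(** * Star complete graphs and their attachment *)

(* P is the nonempty family of the vertex sets of the complete graphs that are
   joined at c. *)
Definition star_complete (C : sgraph) (c : C) : Prop :=
  exists P : {set {set C}},
    [/\ P != set0,
        cover P = setT,
        forall B, B \in P -> c \in B /\ 2 <= #|B|,
        forall B B', B \in P -> B' \in P -> B != B' -> B :&: B' = [set c] &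
        forall x y : C,
          (x -- y) = (x != y) && [exists B in P, (x \in B) && (y \in B)]].

Definition pure (C : sgraph) : Prop :=
  forall Q : {set C}, maxset (@clique C) Q -> 3 <= #|Q|.

Definition non_pure (C : sgraph) : Prop := ~ pure C.

Section Attach.
Variables (G : sgraph) (S : {set G}).
Variables (C : {x : G | x \in S} -> sgraph) (c : forall s, C s).

(* The vertices of G, and the vertices other than the common one of the copy
   of C s, for each s in S; the common vertex c s is identified with s. *)
Definition attach_vertex : finType :=
  (G + {s : {x : G | x \in S} & {y : C s | y != c s}})%type.

Definition attach_edge (u v : attach_vertex) : bool :=
  match u, v with
  | inl x, inl y => x -- y
  | inl x, inr q => (x == val (tag q)) && (c (tag q) -- val (tagged q))
  | inr p, inl y => (y == val (tag p)) && (c (tag p) -- val (tagged p))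
  | inr p, inr q =>
      (tag p == tag q) && (val (tagged p) -- val (tagged_as p q))
  end.

Lemma attach_sym : symmetric attach_edge.
Proof.
move=> [x|[s y]] [x'|[s' y']] //=; first by rewrite sedge_sym.
have [e|] := eqVneq s s'; last by [].
by case: s' / e y' => y'; rewrite !tagged_asE /= sedge_sym.
Qed.

Lemma attach_irrefl : irreflexive attach_edge.
Proof. by case=> [x|[s y]] /=; rewrite ?tagged_asE ?eqxx /= sedge_irrefl. Qed.

Definition attach : sgraph := SGraph attach_sym attach_irrefl.

End Attach.

(** * Duplication *)

Section Duplication.
Variables (G : sgraph) (k : {set G} -> nat).

(* The number of copies x_1, x_2, ... of the vertex x; an edge e containing x
   contributes the first k e of them. *)
Definition copies (x : G) : nat := \max_(y | x -- y) k [set x; y].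

(* The copy x_p (p >= 1) is the pair of x and p - 1, so that the condition
   p + q <= k e + 1 reads (p - 1) + (q - 1) < k e. *)
Definition dup_vertex : finType := {x : G & 'I_(copies x)}.

Definition dup_edge (u v : dup_vertex) : bool :=
  (tag u -- tag v) && (tagged u + tagged v < k [set tag u; tag v]).

Lemma dup_sym : symmetric dup_edge.
Proof. by move=> u v; rewrite /dup_edge sedge_sym addnC setUC. Qed.

Lemma dup_irrefl : irreflexive dup_edge.
Proof. by move=> u; rewrite /dup_edge sedge_irrefl. Qed.

Definition duplication : sgraph := SGraph dup_sym dup_irrefl.

End Duplication.

Definition duplication_const (G : sgraph) (k : nat) : sgraph :=
  @duplication G (fun=> k).

(** * Ideals of a commutative ring *)

Local Open Scope ring_scope.

Record ideal (R : comNzRingType) := Ideal {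
  in_ideal :> R -> Prop;
  ideal0 : in_ideal 0;
  idealD : forall x y, in_ideal x -> in_ideal y -> in_ideal (x + y);
  idealMl : forall a x, in_ideal x -> in_ideal (a * x) }.

Section Ideals.
Variable R : comNzRingType.
Implicit Types (I J p : ideal R) (X : R -> Prop).

Inductive span X : R -> Prop :=
| span0 : span X 0
| span_add a g x : X g -> span X x -> span X (a * g + x).

Lemma spanD X x y : span X x -> span X y -> span X (x + y).
Proof.
move=> sx sy; elim: sx => [|a g z Xg _ IH]; first by rewrite add0r.
by rewrite -addrA; apply: span_add.
Qed.

Lemma spanMl X a x : span X x -> span X (a * x).
Proof.
elim=> [|b g z Xg _ IH]; first by rewrite mulr0; apply: span0.
by rewrite mulrDr mulrA; apply: span_add.
Qed.

Definition ideal_gen X : ideal R :=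
  Ideal (span0 X) (@spanD X) (@spanMl X).

Definition unit_ideal : ideal R :=
  @Ideal R (fun=> True) I (fun _ _ _ _ => I) (fun _ _ _ => I).

Definition ideal_mul I J : ideal R :=
  ideal_gen (fun z => exists x y, [/\ I x, J y & z = x * y]).

Fixpoint ideal_pow I (n : nat) : ideal R :=
  if n is n'.+1 then ideal_mul I (ideal_pow I n') else unit_ideal.

Definition prime_ideal p : Prop :=
  ~ p 1 /\ forall x y, p (x * y) -> p x \/ p y.

(* p belongs to Ass(R/I): it is prime and the annihilator of the class of some
   f in R/I. *)
Definition associated_prime I p : Prop :=
  prime_ideal p /\ exists f, forall x, p x <-> I (x * f).

(* The contraction J R_p \cap R for p prime: x/1 = y/s in R_p for some y in J
   and s outside p. *)
Definition localized J p (x : R) : Prop :=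
  exists s y t, [/\ ~ p s, ~ p t, J y & t * (s * x) = t * y].

Definition in_symbolic_power I (k : nat) (x : R) : Prop :=
  forall p, associated_prime I p -> localized (ideal_pow I k) p x.

Lemma symbolic_power0 I k : in_symbolic_power I k 0.
Proof.
move=> p [[p1 _] _]; exists 1, 0, 1; split=> //; first exact: ideal0.
by rewrite !mulr0.
Qed.

Lemma symbolic_powerD I k x y : in_symbolic_power I k x ->
  in_symbolic_power I k y -> in_symbolic_power I k (x + y).
Proof.
move=> Ix Iy p ap; have [[_ pM] _] := ap.
have [s [z [t [ps pt Jz e]]]] := Ix p ap.
have [s' [z' [t' [ps' pt' Jz' e']]]] := Iy p ap.
exists (s * s'), (s' * z + s * z'), (t * t'); split.
- by case/pM.
- by case/pM.
- by apply: idealD; apply: idealMl.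
have -> : t * t' * (s * s' * (x + y)) =
    s' * t' * (t * (s * x)) + s * t * (t' * (s' * y)) by ring.
rewrite e e'; ring.
Qed.

Lemma symbolic_powerMl I k a x :
  in_symbolic_power I k x -> in_symbolic_power I k (a * x).
Proof.
move=> Ix p /Ix [s [y [t [ps pt Jy e]]]].
exists s, (a * y), t; split=> //; first exact: idealMl.
by rewrite !(mulrCA _ a) e.
Qed.

Definition symbolic_power I (k : nat) : ideal R :=
  Ideal (@symbolic_power0 I k) (@symbolic_powerD I k) (@symbolic_powerMl I k).

Lemma ideal_mul_in I J x y : I x -> J y -> ideal_mul I J (x * y).
Proof.
move=> Ix Jy; rewrite -[x * y]addr0 -[x * y]mul1r.
by apply: span_add; [exists x, y | apply: span0].
Qed.

Lemma ideal_pow_mul I i j x y :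
  ideal_pow I i x -> ideal_pow I j y -> ideal_pow I (i + j) (x * y).
Proof.
elim: i x => [|i IH] x; first by move=> _; apply: idealMl.
move=> /= sx Iy; elim: sx => [|a g z [b [c [Ib Ic ->]]] _ IHz].
  by rewrite mul0r; apply: (ideal0 (ideal_mul _ _)).
rewrite mulrDl; apply: (@idealD _ (ideal_mul _ _)) => //.
rewrite -mulrA; apply: (@idealMl _ (ideal_mul _ _)); rewrite -mulrA.
by apply: ideal_mul_in => //; apply: IH.
Qed.

(* The filtration of the ideal M by the submodules m^i M. *)
Definition adic (m M : ideal R) (i : nat) : ideal R :=
  ideal_mul (ideal_pow m i) M.

Lemma adic_mul (m M : ideal R) i j x y :
  ideal_pow m i x -> adic m M j y -> adic m M (i + j) (x * y).
Proof.
move=> mx; elim=> [|a g z [b [c [mb Mc ->]]] _ IH].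
  by rewrite mulr0; apply: (ideal0 (adic _ _ _)).
rewrite mulrDr; apply: (@idealD _ (adic _ _ _)) => //.
rewrite mulrCA; apply: (@idealMl _ (adic _ _ _)); rewrite mulrA.
by apply: ideal_mul_in => //; apply: ideal_pow_mul.
Qed.

End Ideals.

(** * Associated graded rings and modules *)

Section Graded.
Variables (R : comNzRingType) (F : nat -> ideal R).

(* For a filtration F of ideals, the direct sum of the F i is realized in R[t]
   as the polynomials whose coefficient of t^i lies in F i, for all i. *)
Definition rees : {pred {poly R}} := fun p => `[< forall i, F i p`_i >].

Lemma rees_zmod_closed : zmod_closed rees.
Proof.
split=> [|p q /asboolP Fp /asboolP Fq].
  by apply/asboolP => i; rewrite coef0; apply: ideal0.
apply/asboolP => i; rewrite coefB -mulN1r.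
by apply: idealD => //; apply: idealMl.
Qed.

HB.instance Definition _ :=
  GRing.isZmodClosed.Build {poly R} rees rees_zmod_closed.

Definition rees_mod := {p : {poly R} | p \in rees}.

HB.instance Definition _ := Choice.on rees_mod.
HB.instance Definition _ := SubChoice.on rees_mod.
HB.instance Definition _ := [SubChoice_isSubZmodule of rees_mod by <:].

(* The direct sum of the F i.+1, as a subgroup of the direct sum of the F i. *)
Definition rees_next : {pred rees_mod} :=
  fun u => `[< forall i, F i.+1 (val u)`_i >].

Lemma rees_next_zmod_closed : zmod_closed rees_next.
Proof.
split=> [|u v /asboolP Fu /asboolP Fv].
  by apply/asboolP => i; rewrite raddf0 coef0; apply: ideal0.
apply/asboolP => i; rewrite raddfB coefB -mulN1r.
by apply: idealD => //; apply: idealMl.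
Qed.

HB.instance Definition _ :=
  GRing.isZmodClosed.Build rees_mod rees_next rees_next_zmod_closed.

(* The direct sum of the quotients F i / F i.+1. *)
Definition gr : Type := Quotient.quot rees_next.

HB.instance Definition _ := GRing.Zmodule.on gr.

Definition gr_class (u : rees_mod) : gr := \pi_(Quotient.quot rees_next)%qT u.

(* The elements of F d / F d.+1. *)
Definition gr_homog (d : nat) (x : gr) : Prop :=
  exists (u : rees_mod) (a : R), val u = a *: 'X^d /\ x = gr_class u.

End Graded.

Section GradedAction.
Variables (R : comNzRingType) (F F' : nat -> ideal R).
Hypothesis FF' : forall i j x y, F i x -> F' j y -> F' (i + j)%N (x * y).

Lemma rees_mulP (u : rees_mod F) (v : rees_mod F') :
  val u * val v \in rees F'.
Proof.
case: u v => [p /= /asboolP Fp] [q /= /asboolP Fq]; apply/asboolP => i.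
rewrite coefM; elim/big_ind: _ => [|x y|j _]; first exact: ideal0.
  exact: idealD.
by rewrite -[i in F' i](subnKC (leq_ord j)); apply: FF'.
Qed.

Definition rees_mul (u : rees_mod F) (v : rees_mod F') : rees_mod F' :=
  Sub (val u * val v) (rees_mulP u v).

Definition gr_mul (x : gr F) (y : gr F') : gr F' :=
  gr_class (rees_mul (repr x) (repr y)).

Lemma gr_classP (G : nat -> ideal R) (u v : rees_mod G) :
  reflect (gr_class u = gr_class v) (u - v \in @rees_next R G).
Proof. by rewrite Quotient.idealrBE; apply: eqP. Qed.

Lemma gr_mul_class u v : gr_mul (gr_class u) (gr_class v) =
  gr_class (rees_mul u v).
Proof.
have /gr_classP/asboolP Fu : gr_class (repr (gr_class u)) = gr_class u.
  exact: reprK.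
have /gr_classP/asboolP Fv : gr_class (repr (gr_class v)) = gr_class v.
  exact: reprK.
apply/gr_classP/asboolP => i; move: Fu Fv.
rewrite /gr_mul; set u' := repr _; set v' := repr _ => Fu Fv.
have -> : val (rees_mul u' v' - rees_mul u v) =
    val (u' - u) * val v' + val u * val (v' - v).
  by rewrite !raddfB /=; ring.
rewrite coefD !coefM; apply: idealD.
  elim/big_ind: _ => [|x y|j _]; [exact: ideal0|exact: idealD|].
  rewrite -[i in F' i.+1](subnKC (leq_ord j)) -addSn; apply: FF' => //.
  exact: (asboolP _ (valP v')).
elim/big_ind: _ => [|x y|j _]; [exact: ideal0|exact: idealD|].
rewrite -[i in F' i.+1](subnKC (leq_ord j)) -addnS; apply: FF' => //.
exact: (asboolP _ (valP u)).
Qed.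

End GradedAction.

Section GradedRing.
Variables (R : comNzRingType) (m : ideal R).

Definition gr_ring : Type := gr (ideal_pow m).

HB.instance Definition _ := GRing.Zmodule.on gr_ring.

Lemma gr_surj (F : nat -> ideal R) (x : gr F) : exists u, x = gr_class u.
Proof. by exists (repr x); rewrite /gr_class reprK. Qed.

Lemma gr_classD (F : nat -> ideal R) (u v : rees_mod F) :
  gr_class (u + v) = gr_class u + gr_class v.
Proof. exact: raddfD. Qed.

Lemma rees_oneP : 1 \in rees (ideal_pow m).
Proof.
by apply/asboolP => -[|i] //; rewrite coef1; apply: ideal0.
Qed.

Definition rees_one : rees_mod (ideal_pow m) := Sub 1 rees_oneP.

Definition gr_ring_one : gr_ring := gr_class rees_one.
Definition gr_ring_mul : gr_ring -> gr_ring -> gr_ring :=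
  gr_mul (@ideal_pow_mul R m).

Lemma gr_ring_mulA : associative gr_ring_mul.
Proof.
move=> x y z; have [[u ->] [v ->] [w ->]] :=
  And3 (gr_surj x) (gr_surj y) (gr_surj z).
rewrite /gr_ring_mul !gr_mul_class; congr gr_class.
by apply: val_inj => /=; rewrite mulrA.
Qed.

Lemma gr_ring_mulC : commutative gr_ring_mul.
Proof.
move=> x y; have [[u ->] [v ->]] := conj (gr_surj x) (gr_surj y).
rewrite /gr_ring_mul !gr_mul_class; congr gr_class.
by apply: val_inj => /=; rewrite mulrC.
Qed.

Lemma gr_ring_mul1 : left_id gr_ring_one gr_ring_mul.
Proof.
move=> x; have [u ->] := gr_surj x.
rewrite /gr_ring_mul !gr_mul_class; congr gr_class.
by apply: val_inj => /=; rewrite mul1r.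
Qed.

Lemma gr_ring_mulDl : left_distributive gr_ring_mul +%R.
Proof.
move=> x y z; have [[u ->] [v ->] [w ->]] :=
  And3 (gr_surj x) (gr_surj y) (gr_surj z).
rewrite /gr_ring_mul -gr_classD !gr_mul_class -gr_classD; congr gr_class.
by apply: val_inj; rewrite /= mulrDl.
Qed.

HB.instance Definition _ := GRing.Zmodule_isComPzRing.Build gr_ring
  gr_ring_mulA gr_ring_mulC gr_ring_mul1 gr_ring_mulDl.

End GradedRing.

Section GradedModule.
Variables (R : comNzRingType) (m M : ideal R).

Definition gr_module : Type := gr (adic m M).

HB.instance Definition _ := GRing.Zmodule.on gr_module.

Definition gr_scale : gr_ring m -> gr_module -> gr_module :=
  gr_mul (@adic_mul R m M).

Lemma gr_scaleA a b x : gr_scale a (gr_scale b x) = gr_scale (a * b) x.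
Proof.
have [[u ->] [v ->] [w ->]] := And3 (gr_surj a) (gr_surj b) (gr_surj x).
rewrite /gr_scale [_ * _]gr_mul_class !gr_mul_class; congr gr_class.
by apply: val_inj => /=; rewrite mulrA.
Qed.

Lemma gr_scale1 : left_id 1 gr_scale.
Proof.
move=> x; have [u ->] := gr_surj x.
rewrite /gr_scale gr_mul_class; congr gr_class.
by apply: val_inj => /=; rewrite mul1r.
Qed.

Lemma gr_scaleDr : right_distributive gr_scale +%R.
Proof.
move=> a x y; have [[u ->] [v ->] [w ->]] :=
  And3 (gr_surj a) (gr_surj x) (gr_surj y).
rewrite /gr_scale -gr_classD !gr_mul_class -gr_classD; congr gr_class.
by apply: val_inj; rewrite /= mulrDr.
Qed.

Lemma gr_scaleDl x : {morph gr_scale^~ x : a b / a + b}.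
Proof.
move=> a b; have [[u ->] [v ->] [w ->]] :=
  And3 (gr_surj a) (gr_surj b) (gr_surj x).
rewrite /gr_scale -gr_classD !gr_mul_class -gr_classD; congr gr_class.
by apply: val_inj; rewrite /= mulrDl.
Qed.

HB.instance Definition _ := GRing.Zmodule_isLmodule.Build (gr_ring m) gr_module
  gr_scaleA gr_scale1 gr_scaleDr gr_scaleDl.

End GradedModule.

(** * Linear resolutions and Koszul ideals *)

(* A is a graded ring and N a graded A-module, with homogeneous elements of
   degree d given by Adeg d and Ndeg d. A linear resolution is an exact
   sequence
     ... -> A(-d-2)^(b 2) -> A(-d-1)^(b 1) -> A(-d)^(b 0) -> N -> 0
   of graded modules; its maps act on row vectors by matrices of elements of
   degree 1, and send the basis of A(-d)^(b 0) to elements g j of degree d. *)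
Definition has_linear_resolution (A : comPzRingType) (Adeg : nat -> A -> Prop)
    (N : lmodType A) (Ndeg : nat -> N -> Prop) : Prop :=
  exists (d : nat) (b : nat -> nat) (D : forall i, 'M[A]_(b i.+1, b i))
      (g : 'I_(b 0%N) -> N),
    let aug (v : 'rV[A]_(b 0%N)) : N := \sum_j v 0 j *: g j in
    [/\ forall j, Ndeg d (g j),
        forall i r s, Adeg 1%N (D i r s),
        forall y, exists v, y = aug v,
        forall v, aug v = 0 <-> exists w, v = w *m D 0%N &
        forall i (v : 'rV[A]_(b i.+1)),
          v *m D i = 0 <-> exists w, v = w *m D i.+1].

Definition koszul (R : comNzRingType) (m I : ideal R) : Prop :=
  @has_linear_resolution (gr_ring m) (@gr_homog R (ideal_pow m))
    (gr_module m I) (@gr_homog R (adic m I)).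

(** * Cover ideals *)

Section CoverIdeal.
Variables (K : fieldType) (G : sgraph).

Definition vertex_ring : comNzRingType := {mpoly K[#|G|]}.

Definition vertex_var (v : G) : vertex_ring := 'X_(enum_rank v).

Definition irrelevant_ideal : ideal vertex_ring :=
  ideal_gen (fun f => exists v, f = vertex_var v).

Definition cover_ideal : ideal vertex_ring :=
  ideal_gen (fun f => exists W : {set G},
    vertex_cover W /\ f = \prod_(v in W) vertex_var v).

End CoverIdeal.

(* Main.v *)
Require Import Defs.
From HB Require Import structures.
From mathcomp Require Import mpoly.
From mathcomp Require Import all_boot all_order all_algebra generic_quotient.
From mathcomp Require Import boolp zify ring.

(** Removing from H_k the lowest remaining copy of a vertex, or its closed
neighbourhood, only removes lowest copies of vertices.  So one considers the
induced subgraphs of H_k given by the copies of index >= lo v of every vertex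
v.  If such a subgraph has an edge, it has an edge a - b with N[b] contained in
N[a], whose endpoint a is the lowest copy of: a vertex of S with a
whisker; once the edges at S are gone, the neighbour of a leaf of the forest
G \ S; or the vertex of a complete graph with the least value of lo.  Such an a
is a shedding vertex.

Sending all the copies of v to the variable of v maps J(H_k) onto J(H)^(k).
For an induced subgraph A of H_k and an edge a - b as above, with x the
variable of a and u the image of the product of N(a), the images I, J, I' of
the cover ideals of A, A \ a and A \ N[a] satisfy I = x J + u I', and u I' is
contained in m J since b is redundant in the covers containing the rest of
N(a).  The copies of a vertex having nested neighbourhoods, the sequence
0 -> I'(-1) -> J + I' -> I -> 0 stays exact after passing to associated graded
modules, so a mapping cone gives a linear resolution of gr(I) from those of
gr(J) and gr(I'). *)

Set Implicit Arguments.
Unset Strict Implicit.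
Unset Printing Implicit Defensive.

Import GRing.Theory.

(** * Elimination of dominating vertices *)

(** Stated for vertex subsets of one fixed graph, so that successive deletions stay in the same
    type. At each step the neighbours of [b] in [A] lie in the closed neighbourhood of [a]. One
    derivation drives both vertex decomposability and linear resolutions. *)
Inductive dominated_elimination (G : sgraph) (A : {set G}) : Prop :=
| elim_edgeless : {in A &, forall x y, ~~ (x -- y)} -> dominated_elimination A
| elim_dominating (a b : G) : a \in A -> b \in A -> a -- b ->
    {in A, forall z, b -- z -> (z == a) || (a -- z)} ->
    dominated_elimination (A :\ a) ->
    dominated_elimination (A :\: closed_nbh a) -> dominated_elimination A.

(** An independent set avoiding the closed neighbourhood of [a] contains neither [b] nor a neighbour
    of [b], so adding [b] enlarges it without using [a]. *)
Lemma dominated_vertex_shedding (G : sgraph) (a b : G) : a -- b ->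
  (forall z, b -- z -> (z == a) || (a -- z)) -> shedding a.
Proof.
move=> ab dom A sA iA; apply/negP => /maxsetP [_ maxA].
have bA : b \notin A.
  by apply/negP => /(subsetP sA); rewrite !inE ab orbT.
have nbA z : z \in A -> ~~ (b -- z).
  by move=> /(subsetP sA); rewrite !inE; apply: contra => /dom.
have ba : b != a by apply: contraTneq ab => ->; rewrite sedge_irrefl.
move/negP: bA; apply; rewrite -(maxA (b |: A)) ?setU11 ?subsetU1 //.
apply/andP; split.
  apply/subsetP => z; rewrite !inE => /orP [/eqP -> //|/(subsetP sA)].
  by rewrite !inE negb_or => /andP [].
apply/forall_inP => x xbA; apply/forall_inP => y; move: xbA.
rewrite !inE => /orP [/eqP ->|xA] /orP [/eqP ->|yA].
- by rewrite sedge_irrefl.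
- exact: nbA.
- by rewrite sedge_sym; apply: nbA.
- by move/forall_inP: iA => /(_ x xA) /forall_inP; apply.
Qed.

(** Each [del] creates a new subtype, hence the generalization to any [G'] embedded by [f] as the
    subgraph induced on [A]; composing [f] with [val] handles both deletions. *)
Lemma elimination_vertex_decomposable (G : sgraph) (A : {set G}) :
    dominated_elimination A -> forall (G' : sgraph) (f : G' -> G),
    injective f -> (forall x y, (f x -- f y) = (x -- y)) ->
    (forall y, (y \in A) = [exists x, f x == y]) ->
  vertex_decomposable G'.
Proof.
elim=> {A} [A noe|A a b aA bA ab dom _ IH1 _ IH2] G' f finj fe fA.
  apply: vd_isolated => x y; rewrite -fe; apply: noe; rewrite fA.
    by apply/existsP; exists x.
  by apply/existsP; exists y.
move: aA bA; rewrite !fA => /existsP [x /eqP fx] /existsP [y /eqP fy].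
have fxy : x -- y by rewrite -fe fx fy.
have fin z : f z \in A by rewrite fA; apply/existsP; exists z.
apply: (vd_shed (x := x)).
- apply: dominated_vertex_shedding fxy _ => z yz.
  have := dom (f z) (fin z); rewrite -fx -fy !fe => /(_ yz).
  by rewrite (inj_eq finj).
- apply: (IH1 _ (fun u : del [set x] => f (val u))) => [u v /finj /val_inj||z] //.
  rewrite !inE; apply/andP/existsP => [[za]|[u /eqP <-]].
    rewrite fA => /existsP [w /eqP ew].
    have wP : w \in ~: [set x].
      by rewrite !inE; apply: contraNneq za => e; rewrite -ew e fx.
    by exists (Sub w wP : del [set x]); rewrite /= ew.
  split; last exact: fin.
  by have := valP u; rewrite !inE -fx (inj_eq finj).
- apply: (IH2 _ (fun u : del (closed_nbh x) => f (val u))) => [u v /finj /val_inj||z] //.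
  rewrite !inE; apply/andP/existsP => [[za]|[u /eqP <-]].
    rewrite fA => /existsP [w /eqP ew].
    have wP : w \in ~: closed_nbh x.
      rewrite !inE; apply: contra za => /orP [/eqP e|e].
        by rewrite -ew e fx eqxx.
      by rewrite -ew -fx fe e orbT.
    by exists (Sub w wP : del (closed_nbh x)); rewrite /= ew.
  split; last exact: fin.
  by have := valP u; rewrite !inE -fx (inj_eq finj) fe.
Qed.

(** Without a leaf, a path can always be prolonged at its front: the first vertex has a neighbour
    other than the second one, and acyclicity keeps this neighbour off the path. The paths then
    outgrow [T]. *)
Lemma acyclic_leaf (T : finType) (e : rel T) (x0 y0 : T) :
    symmetric e -> irreflexive e ->
    (forall p, ucycle e p -> size p < 3) -> e x0 y0 ->
  exists j i, e j i /\ forall l, e j l -> l = i.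
Proof.
move=> esym eirr acyclic exy.
have [//|noleaf] := pselect (exists j i, e j i /\ forall l, e j l -> l = i).
have other j i : e j i -> exists2 l, e j l & l != i.
  move=> ji; have [//|H] := pselect (exists2 l, e j l & l != i).
  case: noleaf; exists j, i; split=> // l jl.
  by apply/eqP; apply/negPn/negP => li; apply: H; exists l.
have long n : exists x y p, [/\ size p = n, path e x (y :: p) & uniq (x :: y :: p)].
  elim: n => [|n [x [y [p [sp pp up]]]]].
    exists x0, y0, [::]; split=> //=; first by rewrite exy.
    by rewrite inE andbT; apply: contraTneq exy => ->; rewrite eirr.
  have exy' : e x y by case/andP: pp.
  have [z exz zy] := other _ _ exy'.
  have [zp|zp] := boolP (z \in p).
    move: pp up; case/splitPr: p / zp {sp} => p1 p2 pp up.
    (* The part of the path up to [z], closed by the edge from [z] back to [x], has at least three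
       vertices. *)
    suff /acyclic : ucycle e (x :: y :: rcons p1 z) by rewrite /= size_rcons.
    move: pp up; rewrite -cat_rcons => pp up; apply/andP; split.
      rewrite [cycle _ _]rcons_path -rcons_cons last_rcons esym exz andbT.
      by move: pp; rewrite -cat_cons cat_path => /andP [].
    by move: up; rewrite -!cat_cons cat_uniq => /andP [].
  exists z, x, (y :: p); split; rewrite /= ?sp //.
    by rewrite esym exz.
  move: up => /= -> /=; rewrite !inE !negb_or zy zp !andbT.
  by apply: contraTneq exz => ->; rewrite eirr.
have [x [y [p [sp _ up]]]] := long #|T|.
have := uniq_leq_size up (s2 := enum T) (fun z _ => mem_enum T z).
by rewrite /= sp -cardT ltnNge leqnSn.
Qed.

(** * Elimination in the duplications of a graph *)

Section DuplicationElimination.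
Variables (H : sgraph) (k : nat).
Implicit Types (lo : H -> nat).

Local Notation Hk := (duplication_const H k).

Lemma copies_edge (x y : H) : x -- y -> copies (fun=> k) x = k.
Proof.
move=> xy; apply/eqP; rewrite eqn_leq; apply/andP; split.
  by apply/bigmax_leqP.
exact: (@leq_bigmax_cond _ _ (fun=> k) y).
Qed.

Definition upper_copies lo : {set Hk} := [set u : Hk | lo (tag u) <= tagged u].

Definition delete_lowest lo (i : H) : H -> nat :=
  fun w => if w == i then (lo i).+1 else lo w.

(** The copies of a neighbour [w] adjacent to copy [lo i] of [i] are those of index below
    [k - lo i], an initial segment, so deleting them only raises the threshold of [w]. *)
Definition delete_lowest_nbh lo (i : H) : H -> nat :=
  fun w => if w == i then (lo i).+1
           else if i -- w then maxn (lo w) (k - lo i) else lo w.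

(** The lowest copy of [i] is to dominate the last copy of [j] adjacent to it. The neighbours of
    that copy of [j] have index at most [lo i], so only the [l] with [lo l <= lo i] matter. *)
Lemma elimination_step lo (i j : H) : i -- j -> lo i + lo j < k ->
    (forall l, j -- l -> l != i -> lo l <= lo i -> (i -- l) && (lo i + lo i < k)) ->
    dominated_elimination (upper_copies (delete_lowest lo i)) ->
    dominated_elimination (upper_copies (delete_lowest_nbh lo i)) ->
  dominated_elimination (upper_copies lo).
Proof.
move=> ij lt_k good.
have ai : lo i < copies (fun=> k) i by rewrite (copies_edge ij); lia.
(* Index [k.-1 - lo i] is the largest one whose copy of [j] is adjacent to copy [lo i] of [i]; this
   copy survives because [lo i + lo j < k]. *)
have bj : k.-1 - lo i < copies (fun=> k) j.
  by rewrite (copies_edge (y := i)) 1?sedge_sym //; lia.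
pose a : Hk := Tagged (fun x => 'I_(copies (fun=> k) x)) (Ordinal ai).
pose b : Hk := Tagged (fun x => 'I_(copies (fun=> k) x)) (Ordinal bj).
have aE (u : Hk) : (u == a) = (tag u == i) && (tagged u == lo i :> nat).
  apply/eqP/andP => [->|[]]; first by rewrite /= !eqxx.
  case: u => w r /= /eqP ew; subst w => /eqP er.
  by rewrite /a; congr Tagged; apply: val_inj.
move=> elim1 elim2; apply: (elim_dominating (a := a) (b := b)).
- by rewrite inE /=.
- by rewrite inE /=; lia.
- by rewrite /= /dup_edge /= ij /=; lia.
- move=> u; rewrite inE aE /= /dup_edge /=.
  move: (nat_of_ord (tagged u)) => r; move: (tag u) => w lor /andP [jw lt_r].
  have [ei|ne] := eqVneq w i; first by rewrite ei in lor *; lia.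
  by have /andP [-> lt2] := good _ jw ne ltac:(lia); rewrite /=; lia.
- congr (dominated_elimination _): elim1; apply/setP => u.
  rewrite !inE aE /delete_lowest.
  move: (nat_of_ord (tagged u)) => r; move: (tag u) => w.
  by have [->|ne] := eqVneq w i; lia.
- congr (dominated_elimination _): elim2; apply/setP => u.
  rewrite !inE aE /delete_lowest_nbh /= /dup_edge /=.
  move: (nat_of_ord (tagged u)) => r; move: (tag u) => w.
  have [->|ne] /= := eqVneq w i; first by rewrite sedge_irrefl; lia.
  by case: (i -- w) => /=; lia.
Qed.

(** Adjacency of copies is inherited by lower indices, so an edge survives among the upper copies
    exactly when the lowest remaining copies of its ends are adjacent. Such an edge is called
    active. *)
Definition no_active_edge lo (v : H) := forall w, v -- w -> k <= lo v + lo w.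

Lemma no_active_edge_le lo lo' v :
  (forall w, lo w <= lo' w) -> no_active_edge lo v -> no_active_edge lo' v.
Proof. by move=> le dead w /dead; have := le v; have := le w; lia. Qed.

Lemma delete_lowest_ge lo i w : lo w <= delete_lowest lo i w.
Proof. by rewrite /delete_lowest; case: eqP => [->|]; lia. Qed.

Lemma delete_lowest_nbh_ge lo i w : lo w <= delete_lowest_nbh lo i w.
Proof.
by rewrite /delete_lowest_nbh; case: eqP => [->|]; case: (i -- w); lia.
Qed.

(** The termination measure of the elimination: copy [lo i] of [i] is lost. *)
Lemma card_upper_copies lo lo' (i j : H) : i -- j -> lo i + lo j < k ->
  (forall w, lo w <= lo' w) -> lo i < lo' i ->
  #|upper_copies lo'| < #|upper_copies lo|.
Proof.
move=> ij lt_k le lt; apply/proper_card/properP; split.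
  by apply/subsetP => u; rewrite !inE; apply: leq_trans.
have ai : lo i < copies (fun=> k) i by rewrite (copies_edge ij); lia.
exists (Tagged (fun x => 'I_(copies (fun=> k) x)) (Ordinal ai)); rewrite inE //=.
by rewrite -ltnNge.
Qed.

(** Abstract form of the attached graph: [S] holds the attaching vertices, each with a whisker, [F]
    the other vertices of the original graph, and every remaining vertex lies in complete graphs
    that can be left only through [S]. *)
Variables (S F : {set H}).
Hypothesis leaf : forall v, v \in S ->
  exists t, [/\ t \notin S, v -- t & forall z, t -- z -> z = v].
Hypothesis forest : forall p : seq H,
  {subset p <= F} -> ucycle (@sedge H) p -> size p < 3.
Hypothesis forest_nbh : forall u v, u \in F -> v \notin S -> u -- v -> v \in F.
Hypothesis cliques : forall u v, u \notin S -> u \notin F -> v \notin S -> u -- v ->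
  exists K : {set H}, [/\ u \in K, v \in K, clique K &
    forall j l, j \in K -> j \notin S -> j -- l -> l \in K].

(* A vertex v of S with an active edge has a leaf all of whose copies are
   still present, whose last copy next to the lowest copy of v is dominated. *)
Let leaf_invariant lo := forall v, v \in S -> no_active_edge lo v \/
  exists t, [/\ t \notin S, v -- t, forall z, t -- z -> z = v & lo t = 0].

Lemma upper_copies_elimination lo :
  leaf_invariant lo -> dominated_elimination (upper_copies lo).
Proof.
have [n] := ubnP #|upper_copies lo|; elim: n lo => // n IH lo lt_n inv.
have step i j : i -- j -> lo i + lo j < k ->
    (forall l, j -- l -> l != i -> lo l <= lo i -> (i -- l) && (lo i + lo i < k)) ->
    leaf_invariant (delete_lowest lo i) ->
    leaf_invariant (delete_lowest_nbh lo i) ->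
    dominated_elimination (upper_copies lo).
  move=> ij lt_k good inv1 inv2; apply: (elimination_step ij) => //.
    apply: IH inv1; apply: (@leq_trans #|upper_copies lo|); last exact: lt_n.
    apply: (card_upper_copies ij lt_k (delete_lowest_ge lo i)).
    by rewrite /delete_lowest eqxx.
  apply: IH inv2; apply: (@leq_trans #|upper_copies lo|); last exact: lt_n.
  apply: (card_upper_copies ij lt_k (delete_lowest_nbh_ge lo i)).
  by rewrite /delete_lowest_nbh eqxx.
(* First case: some [v] in [S] has an active edge. Its leaf [t] has no other neighbour, which makes
   the domination condition vacuous. *)
have [|alldead] := pselect (exists2 v, v \in S & ~ no_active_edge lo v).
  move=> [v vS live]; case: (inv v vS) => // -[t [tS vt tleaf lot]].
  have lt_v : lo v < k.
    rewrite ltnNge; apply/negP => le; apply: live => w _; lia.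
  apply: (step v t) => // [|l /tleaf -> /eqP //|v' v'S|v' v'S].
  - by rewrite lot addn0.
  - case: (inv v' v'S) => [d|[t' [t'S v't' t'leaf lot']]].
      by left; apply: no_active_edge_le d => w; apply: delete_lowest_ge.
    right; exists t'; split=> //; rewrite /delete_lowest ifN //.
    by apply: contraNneq t'S => ->.
  - have [-> | ne] := eqVneq v' v.
      (* All neighbours of [v] now start at index [k - lo v] or later, so [v] has no active edge
         left. The leaf of another vertex of [S] is not adjacent to [v] and keeps all its copies. *)
      left=> w vw; rewrite /delete_lowest_nbh eqxx vw.
      by case: eqVneq vw => [->|]; rewrite ?sedge_irrefl //; lia.
    case: (inv v' v'S) => [d|[t' [t'S v't' t'leaf lot']]].
      by left; apply: no_active_edge_le d => w; apply: delete_lowest_nbh_ge.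
    right; exists t'; split=> //; rewrite /delete_lowest_nbh ifN; last first.
      by apply: contraNneq t'S => ->.
    rewrite ifN //; apply: contra ne; rewrite sedge_sym => /t'leaf ->.
    exact: eqxx.
have dead v : v \in S -> no_active_edge lo v.
  by move=> vS; have [//|nd] := pselect (no_active_edge lo v); case: alldead; exists v.
(* From here on no vertex of [S] has an active edge. Raising thresholds preserves this, so the
   invariant holds automatically. *)
have {}step i j : i -- j -> lo i + lo j < k ->
    (forall l, j -- l -> l != i -> lo l <= lo i -> (i -- l) && (lo i + lo i < k)) ->
    dominated_elimination (upper_copies lo).
  move=> ij lt_k good; apply: (step i j) => // v vS; left.
    by apply: (no_active_edge_le _ (dead v vS)) => w; apply: delete_lowest_ge.
  by apply: (no_active_edge_le _ (dead v vS)) => w; apply: delete_lowest_nbh_ge.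
pose active (u v : H) := (u -- v) && (lo u + lo v < k).
have activeC u v : active u v -> active v u.
  by rewrite /active sedge_sym addnC.
have activeS u v : active u v -> u \notin S.
  by move=> /andP [uv lt]; apply/negP => /dead /(_ v uv); lia.
have [[u [v auv]]|noactive] := pselect (exists u v, active u v); last first.
  apply: elim_edgeless => x y; rewrite !inE => lox loy; apply/negP => /andP [xy lt].
  by apply: noactive; exists (tag x), (tag y); rewrite /active xy; lia.
have uS := activeS _ _ auv; have vS := activeS _ _ (activeC _ _ auv).
have [uF|uF] := boolP (u \in F).
  (* Second case: the active edges inside [F] form an acyclic graph; the elimination takes place at
     the neighbour [i] of one of its leaves [j]. *)
  pose e := [rel x y | [&& x \in F, y \in F & active x y]].
  have esym : symmetric e.
    by move=> x y; rewrite /e /= /active sedge_sym addnC andbCA.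
  have eirr : irreflexive e by move=> x; rewrite /e /= /active sedge_irrefl !andbF.
  have [||j [i [eji jleaf]]] := acyclic_leaf (x0 := u) (y0 := v) esym eirr.
  - move=> p /andP [cp up]; apply: forest.
      move=> x xp; have := next_cycle cp xp.
      by case/and3P.
    rewrite /ucycle up andbT; apply: sub_cycle cp => x y.
    by case/and3P => _ _ /andP [].
  - by rewrite /e /= uF auv (forest_nbh uF vS) //; case/andP: auv.
  have /and3P [jF iF /andP [ji lt_ji]] := eji.
  apply: (step i j) => [||l jl li le]; rewrite 1?sedge_sym 1?addnC //.
  (* With [lo l <= lo i], the edge from [j] to [l] is active because the one to [i] is, against [j]
     being a leaf. *)
  have ajl : active j l.
    by rewrite /active jl (leq_ltn_trans _ lt_ji) ?leq_add2l.
  case/eqP: li; apply: jleaf; rewrite /e /= jF ajl.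
  by rewrite (forest_nbh jF _ jl) // (activeS l j) // activeC.
have /andP [uv lt_uv] := auv.
(* Third case: the active edge lies in a complete graph [K]. For [i] with least [lo] in [K] outside
   [S], [lo i + lo i <= lo u + lo v < k], so the lowest copy of [i] dominates. *)
have [K [uK vK clK closedK]] := cliques uS uF vS uv.
have uKS : u \in K :\: S by rewrite inE uS.
have vKS : v \in K :\: S by rewrite inE vS.
case: (@arg_minnP _ u [in K :\: S] lo uKS) => i; rewrite inE => /andP [iS iK] mini.
have [loiu loiv] := (mini u uKS, mini v vKS).
have edgeK x y : x \in K -> y \in K -> x != y -> x -- y.
  move=> xK yK; apply/implyP.
  by move/forall_inP: clK => /(_ x xK) /forall_inP; apply.
have [j [jK jS ji lt_ij]] : exists j, [/\ j \in K, j \notin S, j != i & lo i + lo j < k].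
  have [eu|ne] := eqVneq i u; last first.
    exists u; rewrite eq_sym ne; split=> //.
    by apply: leq_ltn_trans lt_uv; rewrite addnC leq_add2l.
  exists v; rewrite vK vS eu; split=> //.
  by apply: contraTneq uv => ->; rewrite sedge_irrefl.
apply: (step i j) => // [|l jl li le]; first by apply: edgeK; rewrite // eq_sym.
have lK := closedK j l jK jS jl.
apply/andP; split; first by apply: edgeK; rewrite // eq_sym.
exact: leq_ltn_trans (leq_add loiu loiv) lt_uv.
Qed.

Lemma duplication_elimination : dominated_elimination [set: Hk].
Proof.
have -> : [set: Hk] = upper_copies (fun=> 0).
  by apply/setP => u; rewrite !inE.
apply: upper_copies_elimination => v /leaf [t [tS vt tleaf]].
by right; exists t.
Qed.

End DuplicationElimination.

(** * Graphs with star complete graphs attached *)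

Section AttachedStars.
Variables (G : sgraph) (S : {set G}).
Variables (C : {x : G | x \in S} -> sgraph) (c : forall s, C s).
Hypothesis C_star : forall s, star_complete (c s).

Local Notation H := (attach c).

(** Blocks meet only in [c s], so every clique lies in one block. A maximal clique with fewer than
    three vertices is therefore a whole block, of size two, and its vertex other than [c s] is a
    leaf. *)
Lemma star_leaf s : non_pure (C s) ->
  exists2 t, c s -- t & forall z, t -- z -> z = c s.
Proof.
have [P [P0 covP inP PI edgeP]] := C_star s => np.
have cliqueP B : B \in P -> clique B.
  move=> BP; apply/forall_inP => x xB; apply/forall_inP => y yB.
  apply/implyP => xy; rewrite edgeP xy; apply/exists_inP; exists B => //.
  by rewrite xB.
have sameP B B' x : B \in P -> B' \in P -> x \in B -> x \in B' -> x != c s -> B = B'.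
  move=> BP B'P xB xB' xc; apply/eqP; apply: contraTT xc => /(PI _ _ BP B'P) e.
  have : x \in B :&: B' by rewrite inE xB.
  by rewrite e inE => /eqP ->; rewrite eqxx.
have /existsNP [Q /not_implyP [/maxsetP [clQ maxQ] /negP]] :
  ~ forall Q : {set C s}, maxset (@clique (C s)) Q -> 3 <= #|Q| := np.
rewrite -ltnNge => ltQ.
have [B BP sQB] : exists2 B, B \in P & Q \subset B.
  have [sQc|] := boolP (Q \subset [set c s]).
    have /set0Pn [B BP] := P0; exists B => //; apply: subset_trans sQc _.
    by rewrite sub1set; have [] := inP B BP.
  move=> /subsetPn [x xQ]; rewrite inE => xc.
  have : x \in cover P by rewrite covP inE.
  move=> /bigcupP [B BP xB]; exists B => //; apply/subsetP => y yQ.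
  have [<- //|xy] := eqVneq x y.
  have : x -- y.
    by move/forall_inP: clQ => /(_ x xQ) /forall_inP /(_ y yQ) /implyP; apply.
  rewrite edgeP xy => /exists_inP [B' B'P /andP [xB' yB']].
  by rewrite (sameP B B' x).
have eB := maxQ B (cliqueP B BP) sQB; subst B.
have [cQ leQ] := inP Q BP.
have /cards2P [x [y [xy eQ]]] : #|Q| == 2 by rewrite eqn_leq leQ -ltnS ltQ.
have [t [tc eQt]] : exists t, t != c s /\ Q = [set c s; t].
  move: cQ; rewrite eQ !inE => /orP [/eqP ->|/eqP ->].
    by exists y; rewrite eq_sym.
  by exists x; rewrite setUC.
have tQ : t \in Q by rewrite eQt !inE eqxx orbT.
exists t.
  by rewrite edgeP eq_sym tc; apply/exists_inP; exists Q; rewrite ?cQ.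
move=> z; rewrite edgeP => /andP [tz /exists_inP [B BP' /andP [tB]]].
rewrite -(sameP Q B t) // eQt !inE => /orP [/eqP //|/eqP ez].
by rewrite ez eqxx in tz.
Qed.

(** The embedding of [C s] into [H]: [insub] fails exactly at [c s], which is sent to [s]. *)
Definition attach_copy s (y : C s) : H :=
  if insub y is Some y' then inr (Tagged (fun s => {y : C s | y != c s}) y')
  else inl (val s).

Lemma attach_copy_common s : attach_copy (c s) = inl (val s).
Proof. by rewrite /attach_copy insubF ?eqxx. Qed.

Lemma attach_copy_neq s (y : C s) (yc : y != c s) :
  attach_copy y = inr (Tagged (fun s => {y : C s | y != c s}) (Sub y yc)).
Proof. by rewrite /attach_copy insubT. Qed.

Lemma attach_copy_val s (y : {y : C s | y != c s}) :
  attach_copy (val y) = inr (Tagged (fun s => {y : C s | y != c s}) y).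
Proof. by rewrite /attach_copy valK. Qed.

Lemma attach_copy_edge s (x y : C s) :
  (attach_copy x -- attach_copy y) = (x -- y).
Proof.
have [->|xc] := eqVneq x (c s); have [->|yc] := eqVneq y (c s).
- by rewrite !sedge_irrefl.
- by rewrite attach_copy_common (attach_copy_neq yc) /= eqxx.
- rewrite attach_copy_common (attach_copy_neq xc) /= eqxx.
  exact: sedge_sym.
- rewrite (attach_copy_neq xc) (attach_copy_neq yc) /= eqxx /=.
  by rewrite tagged_asE.
Qed.

Hypothesis S_cover : cycle_cover S.
Hypothesis C_non_pure : forall s, non_pure (C s).

(** Attaching adds no edge between vertices of [G], so outside [S] the graph [H] consists of the
    forest left by [S] in [G] and of the blocks without their common vertices. *)
Lemma attach_elimination k : dominated_elimination [set: duplication_const H k].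
Proof.
pose inlS : {set H} := [set inl x | x in S].
pose inlF : {set H} := [set inl x | x in ~: S].
have inlSE x : ((inl x : H) \in inlS) = (x \in S).
  by rewrite mem_imset // => ? ? [].
have inlFE x : ((inl x : H) \in inlF) = (x \notin S).
  by rewrite mem_imset ?inE // => ? ? [].
have inrS q : ((inr q : H) \in inlS) = false by apply/imsetP => -[].
have inrF q : ((inr q : H) \in inlF) = false by apply/imsetP => -[].
apply: (@duplication_elimination H k inlS inlF).
- move=> _ /imsetP [x xS ->]; pose s : {x | x \in S} := Sub x xS.
  have [t ct tleaf] := star_leaf (@C_non_pure s).
  have tc : t != c s by apply: contraTneq ct => ->; rewrite sedge_irrefl.
  exists (attach_copy t); rewrite (attach_copy_neq tc) inrS; split=> //.
    by rewrite /= eqxx.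
  move=> [z|[s' z]] /=; first by case/andP => /eqP ->.
  case/andP => /eqP es; case: s' / es z => z; rewrite tagged_asE /= => /tleaf e.
  by case/negP: (valP z); apply/eqP.
- move=> p pF cp.
  have [p' ep] : exists p' : seq (del S), p = map (fun x => inl (val x)) p'.
    elim: p pF {cp} => [|x p IH] pF; first by exists [::].
    have [|p' ->] := IH; first by move=> y yp; apply: pF; rewrite inE yp orbT.
    have /imsetP [y yS ->] := pF x (mem_head _ _).
    by exists (Sub y yS :: p').
  have vinj : injective (fun x : del S => inl (val x) : H).
    by move=> x y [e]; apply: val_inj.
  rewrite ep size_map; apply: S_cover; move: cp; rewrite ep /ucycle.
  by rewrite (map_inj_uniq vinj) cycle_map.
- move=> _ v /imsetP [x xS ->]; case: v => [y|q]; first by rewrite inlSE inlFE.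
  move=> _ /= /andP [/eqP e _]; move: xS; rewrite inE e => /negP [].
  exact: (valP (tag q)).
- move=> [x|[s x]] v; rewrite ?inlSE ?inlFE; first by move=> ->.
  move=> _ _; case: v => [y|[s' y]] /=.
    by rewrite inlSE => yS /andP [/eqP e]; rewrite e (valP s) in yS.
  move=> _ /andP [/eqP es]; case: s' / es y => y; rewrite tagged_asE /= => xy.
  have [P [P0 covP inP PI edgeP]] := C_star s.
  move: (xy); rewrite edgeP => /andP [_ /exists_inP [B BP /andP [xB yB]]].
  have sameP B' z : B' \in P -> z \in B -> z \in B' -> z != c s -> B = B'.
    move=> B'P zB zB' zc; apply/eqP; apply: contraTT zc => /(PI _ _ BP B'P) e.
    have : z \in B :&: B' by rewrite inE zB.
    by rewrite e inE => /eqP ->; rewrite eqxx.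
  have [cB _] := inP B BP.
  (* The copy of the block [B] containing the given edge; a vertex of [B] other than [c s] lies in
     no other block, so its neighbours all belong to [B]. *)
  exists [set attach_copy z | z in B]; split.
  + by apply/imsetP; exists (val x); rewrite ?attach_copy_val.
  + by apply/imsetP; exists (val y); rewrite ?attach_copy_val.
  + apply/forall_inP => _ /imsetP [z zB ->]; apply/forall_inP => _ /imsetP [w wB ->].
    apply/implyP => zw; rewrite attach_copy_edge edgeP.
    have -> /= : z != w by apply: contraNneq zw => ->.
    by apply/exists_inP; exists B; rewrite ?zB.
  + move=> _ l /imsetP [z zB ->] zS zl.
    have zc : z != c s.
      by apply: contraNneq zS => ->; rewrite attach_copy_common inlSE (valP s).
    move: zl; rewrite (attach_copy_neq zc).
    case: l => [w|[s' w]] /=.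
      move=> /andP [/eqP -> _]; apply/imsetP; exists (c s) => //.
      by rewrite attach_copy_common.
    case/andP => /eqP es; case: s' / es w => w; rewrite tagged_asE /= => zw.
    apply/imsetP; exists (val w); last by rewrite attach_copy_val.
    move: zw; rewrite edgeP => /andP [_ /exists_inP [B' B'P /andP [zB' wB']]].
    by rewrite (sameP B' z).
Qed.

Theorem attach_vertex_decomposable k :
  vertex_decomposable (duplication_const H k).
Proof.
apply: (elimination_vertex_decomposable (attach_elimination k) (f := id)) => // y.
by rewrite inE; apply/esym/existsP; exists y.
Qed.

End AttachedStars.

(** * Linear resolutions *)

(** Serves to build chain maps degree by degree: the types of the matrices depend on the degree, and
    the invariant [Q] is what makes the next lift possible. *)
Lemma dependent_choice (T : nat -> Type) (Q : forall i, T i -> Prop)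
    (R : forall i, T i -> T i.+1 -> Prop) (x0 : T 0) :
    Q 0 x0 -> (forall i x, Q i x -> exists2 y, Q i.+1 y & R i x y) ->
  exists f : forall i, T i,
    [/\ f 0 = x0, forall i, Q i (f i) & forall i, R i (f i) (f i.+1)].
Proof.
move=> Q0 step.
have next i (x : {x : T i | Q i x}) : {y : {y | Q i.+1 y} | R i (sval x) (sval y)}.
  apply: cid; case: x => x Qx; have [y Qy Rxy] := step i x Qx.
  by exists (exist _ y Qy).
pose F := nat_rect (fun i => {x : T i | Q i x}) (exist _ x0 Q0)
  (fun i x => sval (next i x)).
exists (fun i => sval (F i)); split=> // i; first exact: svalP (F i).
exact: svalP (next i (F i)).
Qed.

Section LinearResolutions.
Local Open Scope ring_scope.
Variables (A : comPzRingType) (Adeg : nat -> A -> Prop) (pA : nat -> A -> A).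

(** Homogeneous components are given by projections, so that homogeneity becomes the equation
    [pN d x = x]. The law [proj_scale] allows a coefficient to be replaced by one of its
    components. *)
Record grading (N : lmodType A) (Ndeg : nat -> N -> Prop) (pN : nat -> N -> N) :
    Prop := Grading {
  proj_additive : forall d, {morph pN d : x y / x + y};
  proj_homog : forall d x, Ndeg d (pN d x);
  proj_id : forall d x, Ndeg d x -> pN d x = x;
  proj_scale : forall d e a x, Ndeg e x -> pN (d + e)%N (a *: x) = pA d a *: x }.

Section GradingTheory.
Variables (N : lmodType A) (Ndeg : nat -> N -> Prop) (pN : nat -> N -> N).
Hypothesis NG : grading Ndeg pN.

Lemma proj0 d : pN d 0 = 0.
Proof. by apply: (@addIr _ (pN d 0)); rewrite -(proj_additive NG) !add0r. Qed.

Lemma projN d : {morph pN d : x / - x}.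
Proof.
move=> x; apply: (@addrI _ (pN d x)).
by rewrite -(proj_additive NG) !subrr proj0.
Qed.

Lemma proj_sum d I (s : seq I) (F : I -> N) :
  pN d (\sum_(i <- s) F i) = \sum_(i <- s) pN d (F i).
Proof. exact: (big_morph _ (proj_additive NG d) (proj0 d)). Qed.

Lemma homogP d x : Ndeg d x <-> pN d x = x.
Proof. by split=> [/(proj_id NG)|<-] //; apply: (proj_homog NG). Qed.

Lemma homog0 d : Ndeg d 0.
Proof. by apply/homogP/proj0. Qed.

Lemma homogN d x : Ndeg d x -> Ndeg d (- x).
Proof. by move=> /homogP h; apply/homogP; rewrite projN h. Qed.

Lemma homog_sum d I (s : seq I) (F : I -> N) :
  (forall i, Ndeg d (F i)) -> Ndeg d (\sum_(i <- s) F i).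
Proof.
move=> h; apply/homogP; rewrite proj_sum.
by apply: eq_bigr => i _; apply/homogP.
Qed.

(** Applying the projection of degree [d + e] leaves the homogeneous combination unchanged and cuts
    each coefficient down to its component of degree [d]. *)
Lemma homog_lift n d e (g : 'I_n -> N) (v : 'rV[A]_n) :
    (forall j, Ndeg e (g j)) -> Ndeg (d + e)%N (\sum_j v 0 j *: g j) ->
  \sum_j map_mx (pA d) v 0 j *: g j = \sum_j v 0 j *: g j.
Proof.
move=> hg /homogP he; rewrite -[RHS]he proj_sum.
by apply: eq_bigr => j _; rewrite mxE (proj_scale NG).
Qed.

End GradingTheory.

Hypothesis AG : @grading A^o Adeg pA.

Lemma homog_mul d e a b : Adeg d a -> Adeg e b -> Adeg (d + e)%N (a * b).
Proof.
move=> ha hb; apply/(homogP AG).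
by rewrite [LHS](proj_scale AG d a hb) (proj_id AG).
Qed.

Definition homog_mx d m n (M : 'M[A]_(m, n)) := forall i j, Adeg d (M i j).

Lemma homog_mulmx d e m n p (M : 'M[A]_(m, n)) (M' : 'M_(n, p)) :
  homog_mx d M -> homog_mx e M' -> homog_mx (d + e) (M *m M').
Proof.
move=> h h' i j; rewrite mxE; apply: (homog_sum AG) => l.
exact: homog_mul.
Qed.

Lemma homog_lift_mx m n d e (v : 'rV[A]_m) (D : 'M[A]_(m, n)) :
    homog_mx e D -> homog_mx (d + e) (v *m D) ->
  map_mx (pA d) v *m D = v *m D.
Proof.
move=> hD hv; apply/rowP => j; have := hv 0 j; rewrite !mxE.
exact: (homog_lift AG (g := fun i => D i j)).
Qed.

Definition augmentation n (N : lmodType A) (g : 'I_n -> N) (v : 'rV[A]_n) : N :=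
  \sum_j v 0 j *: g j.

Lemma augmentationD n (N : lmodType A) (g : 'I_n -> N) (v w : 'rV[A]_n) :
  augmentation g (v + w) = augmentation g v + augmentation g w.
Proof. by rewrite -big_split; apply: eq_bigr => j _; rewrite mxE scalerDl. Qed.

Lemma augmentationN n (N : lmodType A) (g : 'I_n -> N) (v : 'rV[A]_n) :
  augmentation g (- v) = - augmentation g v.
Proof. by rewrite -sumrN; apply: eq_bigr => j _; rewrite mxE scaleNr. Qed.

Lemma augmentation_mulmx m n (N : lmodType A) (g : 'I_n -> N) (v : 'rV[A]_m)
    (M : 'M[A]_(m, n)) :
  augmentation g (v *m M) = augmentation (fun i => augmentation g (row i M)) v.
Proof.
rewrite /augmentation.
under eq_bigr do rewrite mxE scaler_suml.
rewrite exchange_big; apply: eq_bigr => i _; rewrite scaler_sumr.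
by apply: eq_bigr => j _; rewrite scalerA mxE.
Qed.

Lemma augmentation_linear n (N N' : lmodType A) (f : {linear N -> N'})
    (g : 'I_n -> N) (v : 'rV[A]_n) :
  f (augmentation g v) = augmentation (f \o g) v.
Proof. by rewrite linear_sum; apply: eq_bigr => j _; rewrite linearZ. Qed.

(** Generators are placed in degree 0: in the associated graded module of an ideal the degree counts
    powers of the maximal ideal, not polynomial degree. *)
Definition linear_resolution (N : lmodType A) (Ndeg : nat -> N -> Prop)
    (b : nat -> nat) (D : forall i, 'M[A]_(b i.+1, b i)) (g : 'I_(b 0) -> N) :=
  [/\ forall j, Ndeg 0 (g j),
      forall i, homog_mx 1 (D i),
      forall y, exists v, y = augmentation g v,
      forall v, augmentation g v = 0 <-> exists w, v = w *m D 0 &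
      forall i (v : 'rV[A]_(b i.+1)),
        v *m D i = 0 <-> exists w, v = w *m D i.+1].

Definition linearly_resolved (N : lmodType A) (Ndeg : nat -> N -> Prop) :=
  exists b D g, @linear_resolution N Ndeg b D g.

(** * Lifting a map of degree one to resolutions *)

Section ChainMap.
Variables (N' N : lmodType A) (Ndeg' : nat -> N' -> Prop).
Variables (Ndeg : nat -> N -> Prop) (pN : nat -> N -> N).
Variables (b' : nat -> nat) (D' : forall i, 'M[A]_(b' i.+1, b' i)).
Variables (g' : 'I_(b' 0) -> N').
Variables (b : nat -> nat) (D : forall i, 'M[A]_(b i.+1, b i)).
Variables (g : 'I_(b 0) -> N) (phi : {linear N' -> N}).
Hypothesis NG : grading Ndeg pN.
Hypothesis phi_deg : forall y, Ndeg' 0 y -> Ndeg 1 (phi y).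
Hypotheses (res' : linear_resolution Ndeg' D' g').
Hypotheses (res : linear_resolution Ndeg D g).

(** The comparison theorem, with homogeneity tracked: rows of [D' i *m Phi i] are cycles of degree
    two, and lift through [D i] to rows of degree one. *)
Lemma chain_map : exists Phi : forall i, 'M[A]_(b' i, b i),
  [/\ forall i, homog_mx 1 (Phi i),
      forall v, augmentation g (v *m Phi 0) = phi (augmentation g' v) &
      forall i, D' i *m Phi i = Phi i.+1 *m D i].
Proof.
have [hg' hD' _ ex0' ex'] := res'; have [hg hD surj ex0 ex] := res.
pose kernel i : 'rV[A]_(b i) -> Prop :=
  match i with
  | 0 => fun v => augmentation g v = 0
  | i.+1 => fun v => v *m D i = 0
  end.
have kerP i v : kernel i v -> exists w, v = w *m D i.
  by case: i v => [|i] v /=; [move/ex0|move/ex].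
have /choice [Phi0 PhiE] : forall j, exists v : 'rV[A]_(b 0),
    homog_mx 1 v /\ augmentation g v = phi (g' j).
  move=> j; have [v ev] := surj (phi (g' j)).
  exists (map_mx (pA 1) v); split.
    by move=> ? ?; rewrite mxE; apply: (proj_homog AG).
  rewrite ev; apply: (homog_lift NG (e := 0) (d := 1)) => //.
  by rewrite -[\sum_j _]ev; apply: phi_deg.
pose Q i (M : 'M[A]_(b' i, b i)) :=
  homog_mx 1 M /\ forall r, kernel i (row r (D' i *m M)).
pose R i (M : 'M[A]_(b' i, b i)) (M' : 'M[A]_(b' i.+1, b i.+1)) :=
  D' i *m M = M' *m D i.
have rowD' i r : exists w, row r (D' i) = w *m D' i.
  by exists (delta_mx 0 r); rewrite -rowE.
have augPhi0 v :
    augmentation g (v *m \matrix_i Phi0 i) = phi (augmentation g' v).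
  rewrite augmentation_mulmx augmentation_linear.
  by apply: eq_bigr => i _; rewrite rowK (PhiE i).2.
have Q0 : Q 0 (\matrix_i Phi0 i).
  split=> [i j|r /=]; first by rewrite mxE; apply: (PhiE i).1.
  rewrite row_mul augPhi0; have /ex0' -> := rowD' 0 r.
  by rewrite linear0.
have step i M : Q i M -> exists2 M', Q i.+1 M' & R i M M'.
  move=> [hM kM]; have [w ew] := choice (fun r => kerP _ _ (kM r)).
  have hDM := homog_mulmx (hD' i) hM.
  (* Only the degree one component of each lift is kept; as the product has degree two and [D i]
     degree one, the product is unchanged. *)
  pose M' := \matrix_r map_mx (pA 1) (w r).
  have eM : D' i *m M = M' *m D i.
    apply/row_matrixP => r; rewrite [RHS]row_mul rowK (homog_lift_mx (e := 1)) -?ew //.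
    by move=> ? j; rewrite mxE; apply: hDM.
  exists M' => //; split=> [r j|r /=].
    by rewrite !mxE; apply: (proj_homog AG).
  rewrite -row_mul -mulmxA -eM mulmxA row_mul row_mul.
  by have /ex' -> := rowD' i.+1 r; rewrite mul0mx.
have [Phi [e0 hPhi PhiD]] := dependent_choice Q0 step.
exists Phi; split=> // [i|v]; first exact: (hPhi i).1.
by rewrite e0.
Qed.

End ChainMap.

(** * Mapping cones *)

Section MappingCone.
Variables (N' N N'' : lmodType A) (Ndeg' : nat -> N' -> Prop).
Variables (Ndeg : nat -> N -> Prop) (pN : nat -> N -> N).
Variables (Ndeg'' : nat -> N'' -> Prop).
Variables (phi : {linear N' -> N}) (psi : {linear N -> N''}).
Hypothesis NG : grading Ndeg pN.
Hypothesis phi_deg : forall y, Ndeg' 0 y -> Ndeg 1 (phi y).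
Hypothesis psi_deg : forall y, Ndeg 0 y -> Ndeg'' 0 (psi y).
Hypothesis phi_inj : forall y, phi y = 0 -> y = 0.
Hypothesis exact : forall y, psi y = 0 <-> exists z, y = phi z.
Hypothesis psi_surj : forall z, exists y, z = psi y.

(** The cone of the chain map lifting [phi] shifts the resolution of [N'] by one homological step;
    as [phi] raises the internal degree by one, the cone is again linear. *)
Lemma linearly_resolved_cokernel :
  linearly_resolved Ndeg' -> linearly_resolved Ndeg -> linearly_resolved Ndeg''.
Proof.
move=> [b' [D' [g' res']]] [b [D [g res]]].
have [Phi [hPhi PhiE PhiD]] := chain_map NG phi_deg res' res.
have [hg' hD' surj' ex0' ex'] := res'; have [hg hD surj ex0 ex] := res.
pose b'' i := if i is i'.+1 then (b i + b' i')%N else b 0%N.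
(* The sign before [D'] turns the commutation [PhiD] into the vanishing of the composite of
   consecutive maps. *)
pose D'' i : 'M[A]_(b'' i.+1, b'' i) :=
  match i with
  | 0 => col_mx (D 0) (Phi 0)
  | i'.+1 => block_mx (D i'.+1) 0 (Phi i'.+1) (- D' i')
  end.
have phiE w : phi (augmentation g' w) = augmentation g (w *m Phi 0) by rewrite PhiE.
have DD' i : D' i.+1 *m D' i = 0.
  apply/row_matrixP => r; rewrite row0 row_mul; apply/ex'.
  by exists (delta_mx 0 r); rewrite -rowE.
have DD i : D i.+1 *m D i = 0.
  apply/row_matrixP => r; rewrite row0 row_mul; apply/ex.
  by exists (delta_mx 0 r); rewrite -rowE.
exists b'', D'', (psi \o g); split=> [j|i|z|v|[|i] v].
- exact: psi_deg.
- case: i => [|i] /= r s; rewrite !mxE.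
    by case: splitP => ? _; [apply: hD|apply: hPhi].
  case: splitP => ? _; rewrite !mxE; case: splitP => ? _; rewrite ?mxE.
  + exact: hD.
  + exact: (homog0 AG).
  + exact: hPhi.
  + by apply: (homogN AG); apply: hD'.
- have [y ->] := psi_surj z; have [v ->] := surj y.
  by exists v; rewrite augmentation_linear.
- rewrite -augmentation_linear exact; split=> [[z]|[w ->]].
    have [w' ->] := surj' z; rewrite phiE => /eqP; rewrite -subr_eq0 -augmentationN.
    rewrite -augmentationD => /eqP /ex0 [w ew].
    by exists (row_mx w w'); rewrite mul_row_col -ew subrK.
  rewrite -[w]hsubmxK mul_row_col augmentationD -phiE.
  have -> : augmentation g (lsubmx w *m D 0) = 0 by apply/ex0; eexists.
  by rewrite add0r; eexists.
- split=> [|[w ->]].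
    rewrite -[v]hsubmxK mul_row_col; set w := lsubmx _; set w' := rsubmx _ => e.
    (* Injectivity of [phi] makes [w'] a boundary [z' *m D' 0]; correcting [w] by [z' *m Phi 1] then
       gives a cycle of the resolution of [N]. *)
    have /ex0' [z' ez'] : augmentation g' w' = 0.
      apply: phi_inj; rewrite phiE -[RHS](_ : augmentation g 0 = 0); last first.
        by rewrite /augmentation big1 // => ? _; rewrite mxE scale0r.
      rewrite -e augmentationD.
      have -> : augmentation g (w *m D 0) = 0 by apply/ex0; eexists.
      by rewrite add0r.
    have /ex [z ez] : (w + z' *m Phi 1%N) *m D 0 = 0.
      by rewrite mulmxDl -mulmxA -PhiD mulmxA -ez'.
    exists (row_mx z (- z')); rewrite mul_row_block -ez mulmx0 add0r.
    by rewrite !mulNmx mulmxN opprK -ez' addrK.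
  rewrite -[w]hsubmxK /= mul_row_block mul_row_col mulmx0 add0r mulmxDl.
  by rewrite mulmxN mulNmx -!mulmxA DD PhiD mulmx0 add0r subrr.
- split=> [|[w ->]].
    rewrite -[v]hsubmxK mul_row_block mulmx0 add0r mulmxN.
    set w := lsubmx _; set w' := rsubmx _.
    rewrite -[RHS](row_mx0 _ 1) => /eq_row_mx [e].
    move=> /eqP; rewrite oppr_eq0 => /eqP /ex' [z' ez'].
    have /ex [z ez] : (w + z' *m Phi i.+2) *m D i.+1 = 0.
      by rewrite mulmxDl -mulmxA -PhiD mulmxA -ez'.
    exists (row_mx z (- z')); rewrite mul_row_block -ez mulmx0 add0r.
    by rewrite !mulNmx mulmxN opprK -ez' addrK.
  rewrite -[w]hsubmxK /= !mul_row_block !mulmx0 !add0r mulmxDl.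
  rewrite !mulmxN !mulNmx -!mulmxA DD PhiD DD' !mulmx0 add0r subrr.
  by rewrite !oppr0 row_mx0.
Qed.

End MappingCone.

(** * Direct sums and free modules of rank one *)

Section DirectSum.
Variables (N1 N2 : lmodType A).
Variables (deg1 : nat -> N1 -> Prop) (p1 : nat -> N1 -> N1).
Variables (deg2 : nat -> N2 -> Prop) (p2 : nat -> N2 -> N2).

Definition pair_homog d (y : N1 * N2) := deg1 d y.1 /\ deg2 d y.2.

Lemma grading_pair : grading deg1 p1 -> grading deg2 p2 ->
  grading pair_homog (fun d y => (p1 d y.1, p2 d y.2)).
Proof.
move=> G1 G2; split=> [d x y|d x|d [x y] [/= h1 h2]|d e a [x y] [/= h1 h2]].
- by rewrite /= (proj_additive G1) (proj_additive G2).
- by split; [apply: (proj_homog G1)|apply: (proj_homog G2)].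
- by rewrite (proj_id G1) ?(proj_id G2).
- by rewrite /= (proj_scale G1) ?(proj_scale G2).
Qed.

Lemma linearly_resolved_pair :
  linearly_resolved deg1 -> linearly_resolved deg2 -> grading deg1 p1 ->
  grading deg2 p2 -> linearly_resolved pair_homog.
Proof.
move=> [b1 [D1 [g1 [hg1 hD1 surj1 ex01 ex1]]]].
move=> [b2 [D2 [g2 [hg2 hD2 surj2 ex02 ex2]]]] G1 G2.
pose g (j : 'I_(b1 0 + b2 0)) : (N1 * N2)%type :=
  match split j with inl j => (g1 j, 0) | inr j => (0, g2 j) end.
have augE v : augmentation g v =
    (augmentation g1 (lsubmx v), augmentation g2 (rsubmx v)).
  have gl j : g (lshift _ j) = (g1 j, 0) by rewrite /g (unsplitK (inl j)).
  have gr j : g (rshift _ j) = (0, g2 j) by rewrite /g (unsplitK (inr j)).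
  rewrite {1}/augmentation big_split_ord [LHS]surjective_pairing /=.
  rewrite !(raddf_sum fst) !(raddf_sum snd) /=.
  rewrite [X in (_ + X, _)]big1 => [|j _]; last by rewrite gr scaler0.
  rewrite [X in (_, X + _)]big1 => [|j _]; last by rewrite gl scaler0.
  rewrite addr0 add0r; congr (_, _); apply: eq_bigr => j _.
    by rewrite gl mxE.
  by rewrite gr mxE.
exists (fun i => b1 i + b2 i)%N, (fun i => block_mx (D1 i) 0 0 (D2 i)), g.
have blockE i (w : 'rV_(b1 i.+1 + b2 i.+1)) : w *m block_mx (D1 i) 0 0 (D2 i) =
    row_mx (lsubmx w *m D1 i) (rsubmx w *m D2 i).
  by rewrite -{1}[w]hsubmxK mul_row_block !mulmx0 addr0 add0r.
split=> [j|i r s|y|v|i v].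
- rewrite /g; case: split => j'; split=> //=.
    exact: (homog0 G2).
  exact: (homog0 G1).
- rewrite !mxE; case: splitP => ? _; rewrite !mxE; case: splitP => ? _.
  + exact: hD1.
  + by rewrite mxE; apply: (homog0 AG).
  + by rewrite mxE; apply: (homog0 AG).
  + exact: hD2.
- case: y => y1 y2; have [[v1 ->] [v2 ->]] := conj (surj1 y1) (surj2 y2).
  by exists (row_mx v1 v2); rewrite augE row_mxKl row_mxKr.
- rewrite augE; split=> [[/ex01 [w1 e1] /ex02 [w2 e2]]|[w ->]].
    by exists (row_mx w1 w2); rewrite blockE row_mxKl row_mxKr -e1 -e2 hsubmxK.
  rewrite blockE row_mxKl row_mxKr; congr (_, _).
    by apply/ex01; eexists.
  by apply/ex02; eexists.
- rewrite blockE -[0](row_mx0 _ 1); split=> [/eq_row_mx []|[w ->]].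
    move=> /ex1 [w1 e1] /ex2 [w2 e2].
    by exists (row_mx w1 w2); rewrite blockE row_mxKl row_mxKr -e1 -e2 hsubmxK.
  rewrite blockE row_mxKl row_mxKr; congr row_mx.
    by apply/ex1; eexists.
  by apply/ex2; eexists.
Qed.

End DirectSum.

Lemma linearly_resolved_free (N : lmodType A) (Ndeg : nat -> N -> Prop) (g : N) :
    Ndeg 0 g -> (forall y, exists a, y = a *: g) ->
    (forall a, a *: g = 0 -> a = 0) ->
  linearly_resolved Ndeg.
Proof.
move=> hg surj inj.
exists (fun i => (i == 0)%N : nat), (fun i => 0), (fun=> g).
have aug1 (v : 'rV_1) : augmentation (fun=> g) v = v 0 0 *: g.
  by rewrite /augmentation big_ord1.
have thin (v w : 'rV[A]_0) : v = w by rewrite [v]thinmx0 [w]thinmx0.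
split=> // [i r s|y|v|i v].
- by rewrite mxE; apply: (homog0 AG).
- by have [a ->] := surj y; exists (const_mx a); rewrite aug1 mxE.
- rewrite aug1; split=> [/inj e|[w ->]]; last by rewrite mulmx0 mxE scale0r.
  by exists 0; rewrite mulmx0; apply/rowP => j; rewrite ord1 e mxE.
- by split=> _; [exists 0; apply: thin|apply: mulmx0].
Qed.

End LinearResolutions.

Local Open Scope ring_scope.

(** * Associated graded modules *)

Section GrComponent.
Variables (R : comNzRingType) (F : nat -> ideal R).

Lemma gr_class_eq0 (u : rees_mod F) :
  gr_class u = 0 <-> forall i, F i.+1 (val u)`_i.
Proof.
have -> : (gr_class u = 0) = (gr_class u = gr_class 0) by rewrite /gr_class raddf0.
split=> [/gr_classP|h]; first by rewrite subr0 => /asboolP.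
by apply/gr_classP; rewrite subr0; apply/asboolP.
Qed.

Lemma rees_in (u : rees_mod F) i : F i (val u)`_i.
Proof. by move: (valP u) => /asboolP. Qed.

Lemma rees_monomialP d (a : R) : F d a -> a *: 'X^d \in rees F.
Proof.
move=> Fa; apply/asboolP => i; rewrite coefZ coefXn.
by case: eqP => [->|_]; rewrite ?mulr1 // mulr0; apply: ideal0.
Qed.

Definition rees_monomial d (a : R) (Fa : F d a) : rees_mod F :=
  Sub (a *: 'X^d) (rees_monomialP Fa).

Definition gr_proj d (x : gr F) : gr F :=
  gr_class (rees_monomial (rees_in (repr x) d)).

Lemma gr_proj_class d u : gr_proj d (gr_class u) =
  gr_class (rees_monomial (rees_in u d)).
Proof.
have /gr_classP/asboolP Fu : gr_class (repr (gr_class u)) = gr_class u.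
  exact: reprK.
apply/gr_classP/asboolP => i; rewrite raddfB /= -scalerBl coefZ coefXn.
case: eqP => [->|_]; last by rewrite mulr0; apply: ideal0.
by rewrite mulr1; have := Fu d; rewrite raddfB coefB.
Qed.

Lemma gr_projD d : {morph gr_proj d : x y / x + y}.
Proof.
move=> x y; have [[u ->] [v ->]] := conj (gr_surj x) (gr_surj y).
rewrite -gr_classD !gr_proj_class -gr_classD; congr gr_class.
by apply: val_inj; rewrite /= coefD scalerDl.
Qed.

Lemma gr_proj_homog d x : gr_homog d (gr_proj d x).
Proof. by do 2 eexists; split; last by []. Qed.

Lemma gr_proj_id d x : gr_homog d x -> gr_proj d x = x.
Proof.
move=> [u [a [ua ->]]]; rewrite gr_proj_class; congr gr_class.
by apply: val_inj; rewrite /= ua coefZ coefXn eqxx mulr1.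
Qed.

Lemma gr_homogE d x : gr_homog d x -> exists a (Fa : F d a),
  x = gr_class (rees_monomial Fa).
Proof.
move=> hx; rewrite -(gr_proj_id hx); do 2 eexists; reflexivity.
Qed.

End GrComponent.

Lemma gr_proj_mul (R : comNzRingType) (F F' : nat -> ideal R)
    (FF' : forall i j x y, F i x -> F' j y -> F' (i + j)%N (x * y))
    d e (a : gr F) (y : gr F') :
  gr_homog e y -> gr_proj (d + e) (gr_mul FF' a y) = gr_mul FF' (gr_proj d a) y.
Proof.
move=> /gr_homogE [b [Fb ->]]; have [u ->] := gr_surj a.
rewrite gr_mul_class !gr_proj_class gr_mul_class; congr gr_class.
apply: val_inj => /=; rewrite -!scalerAr -scalerAl -exprD coefZ coefMXn.
by rewrite ltnNge leq_addl /= addnK scalerA.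
Qed.

Section GrGrading.
Variables (R : comNzRingType) (m : ideal R).

Local Notation A := (gr_ring m).
Local Notation Adeg := (@gr_homog R (ideal_pow m)).

Lemma gr_ring_grading :
  @grading A (@gr_proj R (ideal_pow m)) A^o Adeg (@gr_proj R (ideal_pow m)).
Proof.
split=> [d|d x|d x|d e a x].
- exact: gr_projD.
- exact: gr_proj_homog.
- exact: gr_proj_id.
- exact: gr_proj_mul.
Qed.

Lemma gr_module_grading (M : ideal R) :
  @grading A (@gr_proj R (ideal_pow m)) ( gr_module m M)
    (@gr_homog R (adic m M)) (@gr_proj R (adic m M)).
Proof.
split=> [d|d x|d x|d e a x].
- exact: gr_projD.
- exact: gr_proj_homog.
- exact: gr_proj_id.
- exact: gr_proj_mul.
Qed.

Lemma gr_scale_class (M : ideal R) (p : rees_mod (ideal_pow m))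
    (q : rees_mod (adic m M)) :
  (gr_class p : A) *: (gr_class q : gr_module m M) =
  gr_class (rees_mul (@adic_mul R m M) p q).
Proof. exact: gr_mul_class. Qed.

End GrGrading.

(** * Maps induced by multiplication by a ring element *)

Section GrMap.
Variables (R : comNzRingType) (F F' : nat -> ideal R) (s : nat) (u : R).
Hypothesis uF : forall i x, F i x -> F' (i + s)%N (u * x).

(** On the Rees modules the map is multiplication by [u] and by the power ['X^s], where [s] is the
    shift in degree. *)
Lemma rees_mapP (p : rees_mod F) : u *: (val p * 'X^s) \in rees F'.
Proof.
apply/asboolP => i; rewrite coefZ coefMXn.
case: ltnP => [_|le_si]; first by rewrite mulr0; apply: ideal0.
by rewrite -{1}(subnK le_si); apply: uF; apply: rees_in.
Qed.

Definition rees_map (p : rees_mod F) : rees_mod F' :=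
  Sub (u *: (val p * 'X^s)) (rees_mapP p).

Definition gr_map (x : gr F) : gr F' := gr_class (rees_map (repr x)).

Lemma gr_map_class p : gr_map (gr_class p) = gr_class (rees_map p).
Proof.
have /gr_classP/asboolP Fp : gr_class (repr (gr_class p)) = gr_class p.
  exact: reprK.
apply/gr_classP/asboolP => i; rewrite raddfB /= -scalerBr -mulrBl coefZ coefMXn.
case: ltnP => [_|le_si]; first by rewrite mulr0; apply: ideal0.
rewrite -{1}(subnK le_si) -addSn; apply: uF.
by have := Fp (i - s)%N; rewrite raddfB.
Qed.

Lemma gr_mapD : {morph gr_map : x y / x + y}.
Proof.
move=> x y; have [[p ->] [q ->]] := conj (gr_surj x) (gr_surj y).
rewrite -gr_classD !gr_map_class -gr_classD; congr gr_class.
by apply: val_inj; rewrite /= mulrDl scalerDr.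
Qed.

Lemma gr_map_homog d x : gr_homog d x -> gr_homog (d + s) (gr_map x).
Proof.
move=> [p [a [pa ->]]]; rewrite gr_map_class.
exists (rees_map p), (u * a); split=> //=.
by rewrite pa -scalerAl scalerA exprD.
Qed.

End GrMap.

Section GrLinearMap.
Variables (R : comNzRingType) (m M M' : ideal R) (s : nat) (u : R).
Hypothesis uM : forall i x, adic m M i x -> adic m M' (i + s)%N (u * x).

Definition gr_linear : gr_module m M -> gr_module m M' := gr_map uM.

Lemma gr_linear_is_zmod_morphism : zmod_morphism gr_linear.
Proof.
move=> x y; rewrite [LHS]gr_mapD; congr (_ + _).
apply: (@addrI _ (gr_map uM y)).
rewrite -gr_mapD !subrr /=.
by apply: (@addrI _ (gr_map uM 0)); rewrite -gr_mapD !addr0.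
Qed.

Lemma gr_linear_is_scalable : scalable gr_linear.
Proof.
move=> a x; have [[p ->] [q ->]] := conj (gr_surj a) (gr_surj x).
rewrite gr_scale_class /gr_linear !gr_map_class gr_scale_class; congr gr_class.
by apply: val_inj; rewrite /= -scalerAr mulrA.
Qed.

HB.instance Definition _ :=
  GRing.isZmodMorphism.Build (gr_module m M) (gr_module m M') gr_linear
    gr_linear_is_zmod_morphism.
HB.instance Definition _ :=
  GRing.isScalable.Build (gr_ring m) (gr_module m M) (gr_module m M') *:%R
    gr_linear gr_linear_is_scalable.

End GrLinearMap.

Definition koszul0 (R : comNzRingType) (m I : ideal R) :=
  @linearly_resolved (gr_ring m) (@gr_homog R (ideal_pow m)) (gr_module m I)
    (@gr_homog R (adic m I)).

Lemma koszul0_koszul (R : comNzRingType) (m I : ideal R) :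
  koszul0 m I -> koszul m I.
Proof. by move=> [b [D [g res]]]; exists 0%N, b, D, g. Qed.

Lemma ideal_eq (R : comNzRingType) (I J : ideal R) : (forall x, I x <-> J x) -> I = J.
Proof.
case: I J => I I0 ID IM [J J0 JD JM] /= IJ.
have e : I = J by apply/funext => x; apply/propext.
by case: J / e J0 JD JM IJ => *; congr Ideal; apply: Prop_irrelevance.
Qed.

Lemma adic_unit_ideal (R : comNzRingType) (m : ideal R) n x :
  adic m (unit_ideal R) n x <-> ideal_pow m n x.
Proof.
split=> [|mx]; last by rewrite -[x]mulr1; apply: ideal_mul_in.
elim=> [|a g z [b [c [mb _ ->]]] _ IH]; first exact: ideal0.
by apply: idealD => //; rewrite (mulrC b); do 2!apply: idealMl.
Qed.

Lemma koszul0_unit (R : comNzRingType) (m : ideal R) : koszul0 m (unit_ideal R).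
Proof.
have one1 : adic m (unit_ideal R) 0 1 by apply/adic_unit_ideal.
apply: (linearly_resolved_free (gr_ring_grading m)
  (g := gr_class (rees_monomial one1) : gr_module m (unit_ideal R))).
- by do 2 eexists; split; last by [].
- move=> y; have [u ->] := gr_surj y.
  have hu : val u \in rees (ideal_pow m).
    by apply/asboolP => i; apply/adic_unit_ideal; apply: rees_in.
  exists (gr_class (Sub (val u) hu : rees_mod (ideal_pow m))).
  rewrite gr_scale_class; congr gr_class; apply: val_inj.
  by rewrite /= expr0 alg_polyC mulr1.
- move=> a; have [u ->] := gr_surj a.
  rewrite gr_scale_class => /gr_class_eq0 h; apply/gr_class_eq0 => i.
  by apply/(@adic_unit_ideal _ m); have := h i; rewrite /= expr0 alg_polyC mulr1.
Qed.

(* I = x J + u I' has the resolution obtained from those of J, I' and I'(-1)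
   through the exact sequence 0 -> I'(-1) -> J + I' -> I -> 0, which stays
   exact after passing to associated graded modules. *)
Section Splitting.
Variables (R : comNzRingType) (m I J I' : ideal R) (x u : R).
Hypothesis mx : m x.
Hypothesis xJ : forall f, J f -> I (x * f).
Hypothesis uI' : forall f, I' f -> I (u * f).
Hypothesis split : forall f, I f -> exists g h, [/\ J g, I' h & f = x * g + u * h].
Hypothesis regular :
  forall g h, x * g + u * h = 0 -> exists l, g = - u * l /\ h = x * l.
Hypothesis uI'J : forall n f, adic m I' n f -> adic m J n.+1 (u * f).
Hypothesis strict : forall n l,
  adic m J n (u * l) -> adic m I' n (x * l) -> adic m I' n.-1 l.

Lemma adic_mulr_sub (M M' : ideal R) v : (forall f, M f -> M' (v * f)) ->
  forall n f, adic m M n f -> adic m M' (n + 0) (v * f).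
Proof.
move=> vM n f; rewrite addn0; elim=> [|a g z [b [c [mb Mc ->]]] _ IH].
  by rewrite mulr0; apply: ideal0.
rewrite mulrDr; apply: idealD => //; rewrite mulrCA (mulrCA v).
by apply: idealMl; apply: ideal_mul_in => //; apply: vM.
Qed.

(** [split] is applied to the factor in [I] of each product, so both pieces keep the factor in the
    power of [m]. This gives surjectivity on graded modules. *)
Lemma adic_split n f : adic m I n f ->
  exists g h, [/\ adic m J n g, adic m I' n h & f = x * g + u * h].
Proof.
elim=> [|a e z [b [c [mb Ic ->]]] _ [g [h [Jg I'h ->]]]].
  by exists 0, 0; split; rewrite ?mulr0 ?addr0 //; apply: ideal0.
have [g' [h' [Jg' I'h' ->]]] := split Ic.
exists (a * (b * g') + g), (a * (b * h') + h); split.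
- by apply: idealD => //; apply: idealMl; apply: ideal_mul_in.
- by apply: idealD => //; apply: idealMl; apply: ideal_mul_in.
- by ring.
Qed.

Lemma adicS (M : ideal R) n f : adic m M n f -> adic m M n.+1 (x * f).
Proof.
rewrite -add1n; apply: adic_mul => //.
rewrite -[x]mulr1 [ideal_pow m 1]/(ideal_mul m (unit_ideal R)).
exact: ideal_mul_in.
Qed.

(** Exactness in the middle. Splitting the combination again with terms one step deeper and
    subtracting gives a relation between [x] and [u]; [regular] yields [l], and [strict] locates it
    in the filtration. *)
Lemma adic_kernel n g h : adic m J n g -> adic m I' n h ->
    adic m I n.+1 (x * g + u * h) ->
  exists l, [/\ adic m I' n.-1 l, adic m J n.+1 (g + u * l),
    adic m I' n.+1 (h - x * l) & n = 0%N -> l = 0].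
Proof.
move=> Jg I'h /adic_split [g' [h' [Jg' I'h' e]]].
have down M k f : adic m M k.+1 f -> adic m M k f.
  elim=> [|a e' z [b [c [mb Mc ->]]] _ IH]; first exact: ideal0.
  apply: idealD => //; apply: idealMl.
  elim: mb => [|a' e'' z' [b' [c' [mb' mc' ->]]] _ IH'].
    by rewrite mul0r; apply: ideal0.
  rewrite mulrDl; apply: idealD => //; rewrite -!mulrA; do 2!apply: idealMl.
  exact: ideal_mul_in.
have [|l [el el']] := @regular (g - g') (h - h').
  by rewrite !mulrBr addrACA e -opprD subrr.
have eg : g + u * l = g' by rewrite -(subrK g' g) el; ring.
have eh : h - x * l = h' by rewrite -el'; ring.
have I'l : adic m I' n.-1 l.
  apply: strict.
    have -> : u * l = g' + (-1) * g by rewrite -eg; ring.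
    by apply: idealD; [apply: down|apply: idealMl].
  rewrite -el' -[- h']mulN1r; apply: idealD => //.
  by apply: idealMl; apply: down.
(* There is nothing in degree -1 to lift to. For [n = 0] the products of [l] by [u] and [x] already
   lie one step deeper, so [l] can be replaced by 0. *)
case: n => [|n] in Jg I'h Jg' I'h' I'l *.
  exists 0; rewrite !mulr0 subr0 addr0; split=> //; first exact: ideal0.
    rewrite -(addrK (u * l) g) eg -mulN1r.
    by apply: idealD => //; apply: idealMl; apply: uI'J.
  by rewrite -(subrK (x * l) h) eh; apply: idealD => //; apply: adicS.
by exists l; rewrite eg eh.
Qed.

Lemma koszul0_split : koszul0 m J -> koszul0 m I' -> koszul0 m I.
Proof.
move=> kJ kI'.
(* [phi] is multiplication by [(-u, x)], raising the degree by one; [psi] is multiplication by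
   [(x, u)], preserving it. *)
have mapu n f : adic m I' n f -> adic m J (n + 1) (- u * f).
  by move=> I'f; rewrite addn1 mulNr -mulN1r; apply: idealMl; apply: uI'J.
have mapx n f : adic m I' n f -> adic m I' (n + 1) (x * f).
  by rewrite addn1; apply: adicS.
pose phi (y : gr_module m I') : gr_module m J * gr_module m I' :=
  (gr_linear mapu y, gr_linear mapx y).
have phi_zmod : zmod_morphism phi by move=> y z; rewrite /phi !raddfB.
have phi_scal : scalable phi by move=> a y; rewrite /phi !linearZ.
pose psi (y : gr_module m J * gr_module m I') : gr_module m I :=
  gr_linear (adic_mulr_sub xJ) y.1 + gr_linear (adic_mulr_sub uI') y.2.
have psi_zmod : zmod_morphism psi.
  by move=> y z; rewrite /psi !raddfB /= addrACA opprD.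
have psi_scal : scalable psi.
  by move=> a y; rewrite /psi !linearZ /= -scalerDr.
pose phiM := GRing.isZmodMorphism.Build _ _ phi phi_zmod.
pose phiS := GRing.isScalable.Build _ _ _ _ phi phi_scal.
pose phiL : {linear _ -> _} := HB.pack phi phiM phiS.
pose psiM := GRing.isZmodMorphism.Build _ _ psi psi_zmod.
pose psiS := GRing.isScalable.Build _ _ _ _ psi psi_scal.
pose psiL : {linear _ -> _} := HB.pack psi psiM psiS.
have gG := @gr_module_grading R m.
apply: (@linearly_resolved_cokernel _ _ _ (gr_ring_grading m) (gr_module m I')
  (gr_module m J * gr_module m I')%type (gr_module m I)
  (@gr_homog R (adic m I')) _ _ _ phiL psiL
  (grading_pair (gG J) (gG I'))) => //.
- by move=> y hy; split; apply: (gr_map_homog _ hy).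
- move=> [y z] [/= hy hz]; apply/(homogP (gG I)).
  rewrite (proj_additive (gG I)); congr (_ + _); apply/(homogP (gG I)).
    exact: (gr_map_homog _ hy).
  exact: (gr_map_homog _ hz).
- move=> y; have [p ->] := gr_surj y.
  rewrite /= /phi /gr_linear !gr_map_class.
  move=> [/gr_class_eq0 h /gr_class_eq0 h']; apply/gr_class_eq0 => i.
  have := h i.+1; have := h' i.+1; rewrite /= !coefZ coefMXn /= subn1 /= mulNr.
  (* Both products lie in step [i.+2] of the filtrations; [strict] puts the coefficient in step
     [i.+1], so its class in degree [i] is zero. *)
  move=> h1 h2; apply: (strict (n := i.+2)) => //.
  by rewrite -[_ * _]opprK -mulN1r; apply: idealMl.
- move=> [y z]; have [[p ->] [q ->]] := conj (gr_surj y) (gr_surj z).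
  split=> [|[t ->]].
    rewrite /= /psi /gr_linear !gr_map_class -gr_classD => /gr_class_eq0 h.
    have hl i : exists l, [/\ adic m I' i.-1 l,
        adic m J i.+1 ((val p)`_i + u * l),
        adic m I' i.+1 ((val q)`_i - x * l) & i = 0%N -> l = 0].
      apply: adic_kernel; try exact: rees_in.
      by have := h i; rewrite /= !mulr1 coefD !coefZ.
    have [l hlP] := choice hl.
    pose N := maxn (size (val p)) (size (val q)).
    (* The index is shifted because [phi] also multiplies by ['X]; the term [l 0] lost in this way
       is 0. *)
    have lP : \poly_(i < N) l i.+1 \in rees (adic m I').
      apply/asboolP => i; rewrite coef_poly; case: ifP => _; last exact: ideal0.
      by have [] := hlP i.+1.
    exists (gr_class (Sub (\poly_(i < N) l i.+1) lP : rees_mod (adic m I'))).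
    rewrite /= /phi /gr_linear !gr_map_class.
    have coefl i : (i < N)%N -> ((\poly_(i < N) l i.+1) * 'X)`_i = l i.
      move=> ltN; rewrite coefMX coef_poly; case: i ltN => [|i] ltN /=.
        by have [_ _ _ ->] := hlP 0%N.
      by rewrite ltnW.
    congr (_, _); apply/gr_classP/asboolP => i; rewrite raddfB /= expr1.
      rewrite coefB coefZ.
      case: (ltnP i N) => [ltN|leN].
        by rewrite coefl // mulNr opprK; have [] := hlP i.
      rewrite nth_default; last first.
        by apply: leq_trans leN; rewrite leq_maxl.
      rewrite sub0r coefMX coef_poly.
      case: i leN => [|i] leN /=; first by rewrite mulr0 oppr0; exact: (ideal0 (adic _ _ 1)).
      case: ifP => _; last by rewrite mulr0 oppr0; exact: (ideal0 (adic _ _ i.+2)).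
      rewrite mulNr opprK; have [_ h1 _ _] := hlP i.+1.
      move: h1; rewrite nth_default ?add0r //.
      by apply: leq_trans leN; rewrite leq_maxl.
    rewrite coefB coefZ.
    case: (ltnP i N) => [ltN|leN].
      by rewrite coefl //; have [] := hlP i.
    rewrite nth_default; last first.
      by apply: leq_trans leN; rewrite leq_maxr.
    rewrite sub0r coefMX coef_poly.
    case: i leN => [|i] leN /=; first by rewrite mulr0 oppr0; exact: (ideal0 (adic _ _ 1)).
    case: ifP => _; last by rewrite mulr0 oppr0; exact: (ideal0 (adic _ _ i.+2)).
    have [_ _ h1 _] := hlP i.+1.
    move: h1; rewrite nth_default ?sub0r //.
    by apply: leq_trans leN; rewrite leq_maxr.
  have [r ->] := gr_surj t.
  rewrite /= /psi /phi /gr_linear /= !gr_map_class -gr_classD.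
  apply/gr_class_eq0 => i.
  rewrite [val _](_ : _ = 0) ?coef0; first exact: ideal0.
  by rewrite raddfD /= !mulr1 !scalerA -scalerDl mulrN mulrC addNr scale0r.
- move=> z; have [p ->] := gr_surj z.
  have [g hg] := choice (fun i => adic_split (rees_in p i)).
  have [h ghP] := choice hg.
  have gP : \poly_(i < size (val p)) g i \in rees (adic m J).
    apply/asboolP => i; rewrite coef_poly; case: ifP => _; last exact: ideal0.
    by have [] := ghP i.
  have hP : \poly_(i < size (val p)) h i \in rees (adic m I').
    apply/asboolP => i; rewrite coef_poly; case: ifP => _; last exact: ideal0.
    by have [] := ghP i.
  exists (gr_class (Sub (\poly_(i < size (val p)) g i) gP : rees_mod (adic m J)),
          gr_class (Sub (\poly_(i < size (val p)) h i) hP : rees_mod (adic m I'))).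
  rewrite /= /psi /gr_linear /= !gr_map_class -gr_classD; congr gr_class.
  apply: val_inj; apply/polyP => i; rewrite /= !mulr1 coefD !coefZ !coef_poly.
  case: ltnP => [_|le]; first by have [] := ghP i.
  by rewrite !mulr0 addr0 nth_default.
- exact: (linearly_resolved_pair (gr_ring_grading m) kJ kI' (gG J) (gG I')).
Qed.

End Splitting.

(** * Monomial ideals *)

Section IdealTheory.
Variable R : comNzRingType.

Lemma ideal_gen_sub (X : R -> Prop) (J : ideal R) :
  (forall f, X f -> J f) -> forall f, ideal_gen X f -> J f.
Proof.
move=> XJ f; elim=> [|a g z /XJ Jg _ Jz]; first exact: ideal0.
by apply: idealD => //; apply: idealMl.
Qed.

Lemma ideal_gen_in (X : R -> Prop) f : X f -> ideal_gen X f.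
Proof.
by move=> Xf; rewrite -[f]mul1r -[_ * _]addr0; apply: span_add => //; apply: span0.
Qed.

End IdealTheory.

Section MonomialIdeals.
Variables (K : fieldType) (n : nat).
Local Notation R := ({mpoly K[n]} : comNzRingType).
Implicit Types (P Q : 'X_{1..n} -> Prop) (u w : 'X_{1..n}) (f g : {mpoly K[n]}).

Lemma mpoly_ideal (J : ideal R) f :
  (forall w, w \in msupp f -> J ('X_[w] : {mpoly K[n]})) -> J f.
Proof.
move=> JX; rewrite [f]mpolyE big_seq.
elim/big_ind: _ => [||w wf]; [exact: ideal0|exact: idealD|].
by rewrite -mul_mpolyC; apply: idealMl; apply: JX.
Qed.

Lemma msupp_mul w f g : w \in msupp (f * g) ->
  exists w1 w2, [/\ w1 \in msupp f, w2 \in msupp g & w = (w1 + w2)%MM].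
Proof. by move/msuppM_le/allpairsP => [[w1 w2] /= []]; exists w1, w2. Qed.

Section Def.
Variables (P : 'X_{1..n} -> Prop) (upP : forall u w, P w -> P (u + w)%MM).

Lemma supported0 w : w \in msupp (0 : {mpoly K[n]}) -> P w.
Proof. by rewrite mcoeff_msupp mcoeff0 eqxx. Qed.

Lemma supportedD f g : (forall w, w \in msupp f -> P w) ->
  (forall w, w \in msupp g -> P w) -> forall w, w \in msupp (f + g) -> P w.
Proof.
by move=> Pf Pg w /msuppD_le; rewrite mem_cat => /orP [/Pf|/Pg].
Qed.

Lemma supportedMl a f : (forall w, w \in msupp f -> P w) ->
  forall w, w \in msupp (a * f) -> P w.
Proof. by move=> Pf w /msupp_mul [w1 [w2 [_ /Pf Pw2 ->]]]; apply: upP. Qed.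

(** Given by an up-closed set of exponents rather than by generators, so that membership is tested
    on each monomial of the support. *)
Definition monomial_ideal : ideal R :=
  @Ideal R (fun f => forall w, w \in msupp f -> P w)
    supported0 supportedD supportedMl.

End Def.

Lemma monomial_idealX P upP w : @monomial_ideal P upP 'X_[w] <-> P w.
Proof.
split=> [|Pw w']; first by apply; rewrite msuppX inE.
by rewrite msuppX inE => /eqP ->.
Qed.

Lemma monomial_ideal_mulX P upP Q upQ u f :
  (forall w, P w -> Q (u + w)%MM) ->
  @monomial_ideal P upP f -> @monomial_ideal Q upQ ('X_[u] * f).
Proof.
move=> PQ Pf w /msupp_mul [w1 [w2 [+ w2f ->]]].
by rewrite msuppX inE => /eqP ->; apply/PQ/Pf.
Qed.

Lemma mem_msupp_mulX u f w : w \in msupp f -> (u + w)%MM \in msupp ('X_[u] * f).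
Proof. by rewrite mulrC !mcoeff_msupp mcoeffMX. Qed.

Lemma monomial_ideal_split P upP P1 upP1 P2 upP2 u1 u2 f :
    (forall w, P w -> (exists2 w', w = (u1 + w')%MM & P1 w') \/
      (exists2 w', w = (u2 + w')%MM & P2 w')) ->
    @monomial_ideal P upP f ->
  exists g h, [/\ @monomial_ideal P1 upP1 g, @monomial_ideal P2 upP2 h &
    f = 'X_[u1] * g + 'X_[u2] * h].
Proof.
move=> splitP Pf; rewrite [f]mpolyE big_seq.
elim/big_ind: _ => [|f1 f2 [g1 [h1 [Jg1 Ih1 ->]]] [g2 [h2 [Jg2 Ih2 ->]]]|w wf].
- by exists 0, 0; split; rewrite ?mulr0 ?addr0 //; apply: ideal0.
- exists (g1 + g2), (h1 + h2); split; try exact: idealD.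
  by rewrite !mulrDr addrACA.
- rewrite -mul_mpolyC; case: (splitP w (Pf w wf)) => [] [w' -> Pw'].
    exists ((f@_(u1 + w'))%:MP * 'X_[w']), 0; split; try exact: ideal0.
      by apply: idealMl; apply/monomial_idealX.
    by rewrite mulr0 addr0 mpolyXD mulrCA.
  exists 0, ((f@_(u2 + w'))%:MP * 'X_[w']); split; try exact: ideal0.
    by apply: idealMl; apply/monomial_idealX.
  by rewrite mulr0 add0r mpolyXD mulrCA.
Qed.

(** * Weights and primary monomial ideals *)

Section Primary.
Variable wt : 'X_{1..n} -> nat.
Hypothesis wtD : {morph wt : u w / (u + w)%MM >-> (u + w)%N}.

Lemma wt_ge_up k u w : (k <= wt w)%N -> (k <= wt (u + w)%MM)%N.
Proof. by rewrite wtD; lia. Qed.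

Definition wt_ideal k := monomial_ideal (@wt_ge_up k).

Let part j f : {mpoly K[n]} :=
  \sum_(w <- msupp f | wt w == j) f@_w *: 'X_[w].

Let mcoeff_part j f w : (part j f)@_w = if wt w == j then f@_w else 0.
Proof.
rewrite /part raddf_sum /=.
under eq_bigr do rewrite mcoeffZ mcoeffX.
have [wf|wf] := boolP (w \in msupp f); last first.
  rewrite big1_seq => [|v /andP [_ vf]].
    by rewrite (memN_msupp_eq0 wf) if_same.
  by case: eqVneq => [e|_]; [rewrite -e vf in wf|rewrite mulr0].
rewrite big_mkcond (bigD1_seq w) ?msupp_uniq //= eqxx mulr1 big1 ?addr0 // => v.
by move=> /negPf ->; rewrite mulr0 if_same.
Qed.

(* wt_ideal 1 is prime and wt_ideal k is primary to it: the parts of least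
   weight of f and g multiply to the part of least weight of g * f. *)
Lemma wt_ideal_primary k f g :
  wt_ideal k (g * f) -> ~ wt_ideal 1 g -> wt_ideal k f.
Proof.
move=> + Ng; elim: k => [//|k IH] gf.
have {IH}fk : wt_ideal k f by apply: IH => w /gf; apply: ltnW.
have g0 : part 0 g != 0.
  apply/eqP => g0; apply: Ng => w; rewrite mcoeff_msupp lt0n.
  by apply: contra => /eqP w0; have := mcoeff_part 0 g w; rewrite w0 eqxx g0 mcoeff0 => <-.
have rest_g : wt_ideal 1 (g - part 0 g).
  move=> w; rewrite mcoeff_msupp mcoeffB mcoeff_part lt0n.
  by case: (wt w =P 0%N) => // _; rewrite subrr eqxx.
have rest_f : wt_ideal k.+1 (f - part k f).
  move=> w; rewrite mcoeff_msupp mcoeffB mcoeff_part.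
  case: (wt w =P k) => [_|ne]; first by rewrite subrr eqxx.
  rewrite subr0 -mcoeff_msupp => /fk; lia.
have part_f : wt_ideal k (part k f).
  by move=> w; rewrite mcoeff_msupp mcoeff_part; case: (wt w =P k) => [->|] //; rewrite eqxx.
(* All three terms of the decomposition have weights at least [k.+1], whereas the monomials of this
   product have weight exactly [k]; hence it is zero. *)
have : wt_ideal k.+1 (part 0 g * part k f).
  have -> : part 0 g * part k f =
      g * f + (- part 0 g) * (f - part k f) + - ((g - part 0 g) * f) by ring.
  apply: idealD; first by apply: idealD => //; apply: idealMl.
  rewrite -mulN1r; apply: idealMl => w /msupp_mul [w1 [w2 [/rest_g + /fk + ->]]].
  by rewrite wtD; lia.
move=> h.
have /eqP : part 0 g * part k f = 0.
  apply/mpolyP => w; rewrite mcoeff0; apply/eqP; rewrite mcoeff_eq0.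
  apply/negP => wgf; have := h _ wgf; move: wgf => /msupp_mul [w1 [w2 []]].
  rewrite !mcoeff_msupp !mcoeff_part.
  case: (wt w1 =P 0%N) => [e1 _|]; last by rewrite eqxx.
  case: (wt w2 =P k) => [e2 _ ->|]; last by rewrite eqxx.
  by rewrite wtD; lia.
rewrite mulf_eq0 (negPf g0) => /eqP f0 w wf.
have := fk w wf; rewrite leq_eqVlt => /orP [/eqP ek|//].
have := mcoeff_part k f w; rewrite f0 mcoeff0 ek eqxx => /esym/eqP.
by rewrite mcoeff_eq0 wf.
Qed.

End Primary.

(** As ['X_i] does not divide ['X_[u]], it divides every monomial of [g]: otherwise ['X_[u] * g], a
    multiple of ['X_i], would have a monomial free of that variable. *)
Lemma mpolyX_syzygy (i : 'I_n) u f g : u i = 0%N -> 'X_i * f + 'X_[u] * g = 0 ->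
  exists l, f = - 'X_[u] * l /\ g = 'X_i * l.
Proof.
move=> ui e; have X0 : ('X_i : {mpoly K[n]}) != 0.
  by apply/eqP => /mpolyP /(_ U_(i)%MM); rewrite mcoeffX eqxx mcoeff0 => /eqP; rewrite oner_eq0.
suff [l el] : exists l, g = 'X_i * l.
  exists l; split=> //; apply: (mulfI X0); apply/eqP.
  by rewrite -subr_eq0 mulNr mulrN opprK mulrCA -el e.
exists (\sum_(w <- msupp g) g@_w *: 'X_[w - U_(i)]).
rewrite {1}[g]mpolyE mulr_sumr big_seq [RHS]big_seq; apply: eq_bigr => w wg.
rewrite -scalerAr -mpolyXD addmC submK // lep1mP; apply/negP => /eqP wi.
have := mem_msupp_mulX u wg; rewrite mcoeff_msupp.
have -> : 'X_[u] * g = 'X_i * - f.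
  by apply/eqP; rewrite -subr_eq0 mulrN opprK addrC e.
rewrite -mcoeff_msupp => /msupp_mul [w1 [w2 [+ _ /mnmP /(_ i)]]].
by rewrite msuppX inE => /eqP ->; rewrite !mnmDE ui wi mnm1E eqxx.
Qed.

End MonomialIdeals.

(** * Depolarized cover ideals *)

Section IrrelevantIdeal.
Variables (K : fieldType) (H : sgraph).
Local Notation n := #|H|.
Local Notation m := (irrelevant_ideal K H).

Lemma degree_ge_up d (u w : 'X_{1..n}) : (d <= mdeg w)%N -> (d <= mdeg (u + w))%N.
Proof. by rewrite mdegD; lia. Qed.

Lemma irrelevantX i : m ('X_i : {mpoly K[n]}).
Proof.
by apply: ideal_gen_in; exists (enum_val i); rewrite /vertex_var enum_valK.
Qed.

Lemma irrelevant_powX d (w : 'X_{1..n}) :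
  (d <= mdeg w)%N -> ideal_pow m d ('X_[w] : {mpoly K[n]}).
Proof.
elim: d w => [//|d IH] w lt.
have [i wi] : exists i, w i != 0%N.
  apply/existsP; apply: contraTT lt => /existsPn w0.
  by rewrite mdegE big1 // => i _; have := w0 i; rewrite negbK => /eqP.
have le : (U_(i) <= w)%MM by rewrite lep1mP.
rewrite -(submK le) addmC mpolyXD; apply: ideal_mul_in; first exact: irrelevantX.
by apply: IH; have := congr1 mdeg (submK le); rewrite mdegD mdeg1; lia.
Qed.

Lemma irrelevant_pow_degree d (f : {mpoly K[n]}) w :
  ideal_pow m d f -> w \in msupp f -> (d <= mdeg w)%N.
Proof.
elim: d f w => [//|d IH] f w mf; move: w.
change (monomial_ideal K (@degree_ge_up d.+1) f).
apply: ideal_gen_sub mf => _ [b [c [mb mc ->]]] w /msupp_mul [w1 [w2 [+ /(IH _ _ mc)]]].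
have : monomial_ideal K (@degree_ge_up 1) b.
  apply: ideal_gen_sub mb => _ [v ->].
  by apply/monomial_idealX; rewrite mdeg1.
by move=> b1 /b1 ? ? ->; rewrite mdegD; lia.
Qed.

End IrrelevantIdeal.

(** * Depolarized covers of subgraphs of the duplication *)

Section Covers.
Variables (K : fieldType) (H : sgraph) (k : nat).
Local Notation n := #|H|.
Local Notation Hk := (duplication_const H k).
Local Notation m := (irrelevant_ideal K H).
Implicit Types (A W : {set Hk}) (w : 'X_{1..n}).

(* The exponent of the image of the product of the vertices in W under the
   depolarization sending all the copies of a vertex of H to this vertex. *)
Definition depolarize W : 'X_{1..n} := (\sum_(z in W) U_(enum_rank (tag z)))%MM.

Lemma depolarizeE W v :
  depolarize W (enum_rank v) = #|[set z in W | tag z == v]|.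
Proof.
rewrite /depolarize mnm_sumE -sum1dep_card big_mkcondr /=.
by apply: eq_bigr => z _; rewrite mnm1E (inj_eq enum_rank_inj); case: eqP.
Qed.

Lemma mdeg_depolarize W : mdeg (depolarize W) = #|W|.
Proof.
by rewrite /depolarize mdeg_sum (eq_bigr (fun=> 1%N)) ?sum1_card // => z _; apply: mdeg1.
Qed.

Lemma mnm_lep_enum_rank (u v : 'X_{1..n}) :
  (forall x, u (enum_rank x) <= v (enum_rank x))%N -> (u <= v)%MM.
Proof. by move=> le; apply/mnm_lepP => i; rewrite -(enum_valK i). Qed.

Lemma depolarizeS W W' : W \subset W' -> (depolarize W <= depolarize W')%MM.
Proof.
move=> sWW'; apply: mnm_lep_enum_rank => v; rewrite !depolarizeE; apply: subset_leq_card.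
by apply/subsetP => z; rewrite !inE => /andP [/(subsetP sWW') -> ->].
Qed.

Lemma depolarizeID W N :
  depolarize W = (depolarize (W :&: N) + depolarize (W :\: N))%MM.
Proof. exact: big_setID. Qed.

Lemma depolarizeU1 a W : a \notin W ->
  depolarize (a |: W) = (U_(enum_rank (tag a)) + depolarize W)%MM.
Proof. exact: big_setU1. Qed.

Lemma depolarizeU1_le a W :
  (depolarize (a |: W) <= U_(enum_rank (tag a)) + depolarize W)%MM.
Proof.
have [aW|aW] := boolP (a \in W); last by rewrite depolarizeU1 ?lepm_refl.
by rewrite (setUidPr _) ?sub1set // lem_addl.
Qed.

Lemma depolarizeU_le W W' :
  (depolarize (W :|: W') <= depolarize W + depolarize W')%MM.
Proof.
rewrite (depolarizeID _ W) setUK addmC [X in (_ <= X)%MM]addmC.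
apply/mnm_lepP => i; rewrite !mnmDE leq_add2r.
move: i; apply/mnm_lepP/depolarizeS.
by apply/subsetP => z; rewrite !inE => /andP [/negPf ->].
Qed.

Definition covers A W := [forall x in A, forall y in A,
  (x -- y) ==> (x \in W) || (y \in W)].

Lemma coversP A W :
  reflect {in A &, forall x y, x -- y -> (x \in W) || (y \in W)} (covers A W).
Proof.
apply: (iffP forall_inP) => [h x y xA yA|h x xA].
  by apply/implyP; move/forall_inP: (h x xA); apply.
by apply/forall_inP => y yA; apply/implyP; apply: h.
Qed.

(** The exponents of the monomials in the [d]-th power of [m] times the ideal of [A]: at least [d]
    further variables beside those of a depolarized cover. *)
Definition covered A d w := exists W,
  [/\ covers A W, (depolarize W <= w)%MM & (#|W| + d <= mdeg w)%N].

Lemma covered0 A w : covered A 0 w <-> exists2 W, covers A W & (depolarize W <= w)%MM.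
Proof.
split=> [[W [cW dW _]]|[W cW dW]]; exists W => //; split=> //.
by rewrite addn0 -mdeg_depolarize -(submK dW) mdegD leq_addl.
Qed.

Lemma coveredD A d e u w : (d <= mdeg u)%N -> covered A e w ->
  covered A (d + e) (u + w)%MM.
Proof.
move=> le [W [cW dW lt]]; exists W; split=> //; last by rewrite mdegD; lia.
by apply: lepm_trans dW _; apply: lem_addl.
Qed.

Lemma covered_up A d u w : covered A d w -> covered A d (u + w)%MM.
Proof. exact: (@coveredD A 0). Qed.

Definition partial_cover_ideal A : ideal (vertex_ring K H) :=
  monomial_ideal K (@covered_up A 0).

Local Notation I := partial_cover_ideal.

Lemma adic_partial_cover A d f :
  adic m (I A) d f <-> monomial_ideal K (@covered_up A d) f.
Proof.
split=> [|hf].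
  apply: ideal_gen_sub => _ [b [c [mb Ic ->]]] w /msupp_mul [w1 [w2 [w1b /Ic w2c ->]]].
  by rewrite -[d]addn0; apply: coveredD w2c; apply: irrelevant_pow_degree mb w1b.
apply: mpoly_ideal => w /hf [W [cW dW lt]].
rewrite -(submK dW) mpolyXD; apply: ideal_mul_in.
  apply: irrelevant_powX.
  by have := congr1 mdeg (submK dW); rewrite mdegD mdeg_depolarize; lia.
by apply/monomial_idealX/covered0; exists W => //; apply: lepm_refl.
Qed.

Lemma nested_copies (a z b : Hk) :
  tag z = tag a -> (tagged z <= tagged a)%N -> a -- b -> z -- b.
Proof.
move=> tz le /andP [ab lt]; apply/andP; split; first by rewrite tz.
by apply: leq_ltn_trans lt; rewrite leq_add2r.
Qed.

(** * Splitting the ideal at a dominating vertex *)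

Section Step.
Variables (A : {set Hk}) (a b : Hk).
Hypotheses (aA : a \in A) (bA : b \in A) (ab : a -- b).
Hypothesis dominated : {in A, forall z, b -- z -> (z == a) || (a -- z)}.

Let N := [set z in A | a -- z].
Let A1 := A :\ a.
Let A2 := A :\: closed_nbh a.
Let v := enum_rank (tag a).

Let A2E : A2 = A1 :\: N.
Proof.
apply/setP => z; rewrite !inE negb_or.
by case: (z \in A); rewrite /= ?andbF ?andbT // andbC.
Qed.

Let A1I z : z != a -> z \in A -> z \in A1.
Proof. by move=> za zA; apply/setD1P. Qed.

Let A12 z : z \in A1 -> z \notin N -> z \in A2.
Proof. by move=> zA zN; rewrite A2E in_setD zN. Qed.

Let aN : a \notin N.
Proof. by rewrite inE sedge_irrefl andbF. Qed.

Let u_v : depolarize N v = 0%N.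
Proof.
rewrite depolarizeE; apply: eq_card0 => z; rewrite !inE /= /dup_edge.
by apply/negP => /andP [/andP [_ /andP [e _]] /eqP tz]; rewrite tz sedge_irrefl in e.
Qed.

Let covers_addN W : covers A2 W -> covers A1 (W :|: N).
Proof.
move=> /coversP cW; apply/coversP => x y xA yA xy; rewrite !(in_setU _ W).
have [|xN] := boolP (x \in N); first by rewrite orbT.
have [|yN] := boolP (y \in N); first by rewrite !orbT.
by rewrite !orbF; apply: cW => //; apply: A12.
Qed.

(** A cover of [A] contains [a], and the rest covers [A1], or it contains all of [N], and the rest
    covers [A2]. *)
Lemma covered_step d w : covered A d w ->
  (exists2 w', w = (U_(v) + w')%MM & covered A1 0 w') \/
  (exists2 w', w = (depolarize N + w')%MM & covered A2 0 w').
Proof.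
move=> [W [/coversP cW dW _]]; have [aW|aW] := boolP (a \in W).
  have eW : depolarize W = (U_(v) + depolarize (W :\ a))%MM.
    by rewrite -{1}(setD1K aW) depolarizeU1 ?setD11.
  left; exists (w - U_(v))%MM; last first.
    apply/covered0; exists (W :\ a).
      apply/coversP => x y; rewrite !inE => /andP [xa xA] /andP [ya yA].
      by rewrite xa ya; apply: cW.
    apply/mnm_lepP => i; move/mnm_lepP: dW => /(_ i).
    by rewrite eW mnmDE mnmBE; lia.
  rewrite addmC submK //; apply: lepm_trans dW.
  by rewrite eW lem_addr.
have sNW : N \subset W.
  apply/subsetP => z; rewrite inE => /andP [zA az].
  by have := cW a z aA zA az; rewrite (negPf aW).
have eW : depolarize W = (depolarize N + depolarize (W :\: N))%MM.
  by rewrite (depolarizeID W N) (setIidPr sNW).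
right; exists (w - depolarize N)%MM.
  by rewrite addmC submK //; apply: lepm_trans dW; rewrite eW lem_addr.
apply/covered0; exists (W :\: N).
  apply/coversP => x y; rewrite A2E => /setDP [xA xN] /setDP [yA yN] xy.
  rewrite !in_setD xN yN /=; apply: cW xy.
    by case/setD1P: xA.
  by case/setD1P: yA.
apply/mnm_lepP => i; move/mnm_lepP: dW => /(_ i).
by rewrite eW mnmDE mnmBE; lia.
Qed.

Lemma covered_add_vertex w : covered A1 0 w -> covered A 0 (U_(v) + w)%MM.
Proof.
move=> /covered0 [W /coversP cW dW]; apply/covered0; exists (a |: W).
  apply/coversP => x y xA yA xy; rewrite !in_setU1.
  have [//|xa] := eqVneq x a; have [|ya] := eqVneq y a; first by rewrite orbT.
  by apply: cW => //; apply: A1I.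
apply: lepm_trans (depolarizeU1_le a W) _.
by apply/mnm_lepP => i; rewrite !mnmDE leq_add2l; apply/mnm_lepP.
Qed.

Lemma covered_add_nbh w : covered A2 0 w -> covered A 0 (depolarize N + w)%MM.
Proof.
move=> /covered0 [W cW dW]; apply/covered0; exists (W :|: N).
  apply/coversP => x y xA yA xy.
  have [exa|xa] := eqVneq x a.
    by move: xy; rewrite exa !in_setU => ay; rewrite [y \in N]inE yA ay !orbT.
  have [eya|ya] := eqVneq y a.
    by move: xy; rewrite eya !in_setU sedge_sym => ax; rewrite [x \in N]inE xA ax !orbT.
  by apply/(coversP _ _ (covers_addN cW)) => //; apply: A1I.
apply: lepm_trans (depolarizeU_le W N) _.
by apply/mnm_lepP => i; rewrite !mnmDE addnC leq_add2l; apply/mnm_lepP.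
Qed.

(* The neighbour b of a is redundant in a cover containing all the other
   neighbours of a, since these include the neighbours of b. *)
Lemma covered_nbh_strict d w :
  covered A2 d w -> covered A1 d.+1 (depolarize N + w)%MM.
Proof.
move=> [W [cW dW lt]]; have bN : b \in N by rewrite inE bA ab.
exists ((W :|: N) :\ b); split.
- apply/coversP => x y xA yA xy; rewrite !in_setD1.
  have := coversP _ _ (covers_addN cW) x y xA yA xy.
  have inN z : z \in A1 -> b -- z -> z \in N.
    move=> /setD1P [za zA] bz; rewrite inE zA /=.
    by have := dominated zA bz; rewrite (negPf za).
  have [exb _|xb] := eqVneq x b.
    have yN : y \in N by apply: inN; rewrite -?exb.
    have -> : y != b by apply: contraTneq xy => ->; rewrite exb sedge_irrefl.
    by rewrite !in_setU yN !orbT.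
  have [eyb _|yb //] := eqVneq y b.
  have xN : x \in N by apply: inN; rewrite // -eyb sedge_sym.
  by rewrite !in_setU xN !orbT.
- apply: lepm_trans (depolarizeS (subsetDl _ _)) _.
  apply: lepm_trans (depolarizeU_le W N) _.
  by apply/mnm_lepP => i; rewrite !mnmDE addnC leq_add2l; apply/mnm_lepP.
- have := cardsD1 b (W :|: N); rewrite in_setU bN orbT mdegD mdeg_depolarize.
  have [+ _] := leq_card_setU W N; lia.
Qed.

(** If [W1] contains [N], removing [N] from it gives the cover. Otherwise [W2] works after
    discarding the copies of [tag a] that it does not need; [W1] bounds the number of those kept. *)
Lemma covered_common d w : covered A1 d (depolarize N + w)%MM ->
  covered A2 d (U_(v) + w)%MM -> covered A2 d.-1 w.
Proof.
move=> [W1 [/coversP c1 d1 l1]] [W2 [/coversP c2 d2 l2]].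
rewrite mdegD mdeg_depolarize in l1; rewrite mdegD mdeg1 in l2.
have [sNW|] := boolP (N \subset W1).
  have eW : depolarize W1 = (depolarize N + depolarize (W1 :\: N))%MM.
    by rewrite (depolarizeID W1 N) (setIidPr sNW).
  exists (W1 :\: N); split.
  - apply/coversP => x y; rewrite A2E => /setDP [xA xN] /setDP [yA yN] xy.
    by rewrite !in_setD xN yN; apply: c1.
  - apply/mnm_lepP => i; move/mnm_lepP: d1 => /(_ i).
    by rewrite eW !mnmDE leq_add2l.
  - have := cardsD W1 N; rewrite (setIidPr sNW).
    have := subset_leq_card sNW; lia.
move=> /subsetPn [z zN zW1].
(* The lower copies of [tag a] are also adjacent to the uncovered neighbour [z], so [W1] must
   contain them. *)
have lowW1 y : y \in A -> tag y = tag a -> (tagged y < tagged a)%N -> y \in W1.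
  move=> yA ty lt; move: (zN); rewrite inE => /andP [zA az].
  have yz : y -- z by apply: nested_copies az => //; apply: ltnW.
  have yA1 : y \in A1.
    by apply: A1I yA; apply: contraTneq lt => ->; rewrite ltnn.
  have zA1 : z \in A1.
    by apply: A1I zA; apply: contraNneq aN => <-.
  by have := c1 y z yA1 zA1 yz; rewrite (negPf zW1) orbF.
pose W3 := [set y in W2 | (tag y == tag a) ==> (y \in A) && (tagged y < tagged a)%N].
have sW32 : W3 \subset W2 by apply/subsetP => y; rewrite inE => /andP [].
have cW3 : covers A2 W3.
  (* A copy of [tag a] of index at least that of [a] has all its neighbours adjacent to [a], hence
     none in [A2]. *)
  have keep x y : x \in A2 -> y \in A2 -> x -- y -> x \in W2 -> x \in W3.
    move=> xA yA xy xW; rewrite inE xW /=; apply/implyP => /eqP tx.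
    move: (xA) (yA); rewrite !inE => /andP [_ ->] /andP [+ _].
    apply: contraR; rewrite /= -leqNgt => le; apply/orP; right.
    exact: nested_copies xy.
  apply/coversP => x y xA yA xy; have /orP [xW|yW] := c2 x y xA yA xy.
    by rewrite (keep x y).
  by rewrite (keep y x) ?orbT // sedge_sym.
have dW3 : (depolarize W3 <= w)%MM.
  (* At [v] the bound comes from [W1], since [N] contributes nothing there; elsewhere it comes from
     [W2], since the extra variable is that of [v]. *)
  apply: mnm_lep_enum_rank => x; have [->|xa] := eqVneq x (tag a).
    move/mnm_lepP: d1 => /(_ v); rewrite mnmDE u_v add0n.
    apply: leq_trans; rewrite !depolarizeE; apply: subset_leq_card.
    apply/subsetP => y; rewrite !inE => /andP [/andP [_ h] ty].
    move: h; rewrite ty /= => /andP [yA lt]; rewrite andbT.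
    by apply: lowW1 => //; apply/eqP.
  have := mnm_lepP (lepm_trans (depolarizeS sW32) d2) (enum_rank x).
  by rewrite mnmDE mnm1E (inj_eq enum_rank_inj) eq_sym (negPf xa).
exists W3; split=> //.
have := subset_leq_card sW32; have := mdegD (w - depolarize W3)%MM (depolarize W3).
rewrite submK // mdeg_depolarize; lia.
Qed.

Lemma koszul0_step : koszul0 m (I A1) -> koszul0 m (I A2) -> koszul0 m (I A).
Proof.
apply: (koszul0_split (x := 'X_v : {mpoly K[n]})
  (u := 'X_[depolarize N] : {mpoly K[n]})).
- exact: irrelevantX.
- by move=> f; apply: monomial_ideal_mulX => w; apply: covered_add_vertex.
- by move=> f; apply: monomial_ideal_mulX => w; apply: covered_add_nbh.
- by move=> f; apply: monomial_ideal_split => w; apply: covered_step.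
- by move=> g h; apply: mpolyX_syzygy.
- move=> d f /adic_partial_cover Jf; apply/adic_partial_cover.
  by apply: monomial_ideal_mulX Jf => w; apply: covered_nbh_strict.
- move=> d l /adic_partial_cover Jl /adic_partial_cover Il.
  apply/adic_partial_cover => w wl; apply: covered_common.
    exact: Jl (mem_msupp_mulX _ wl).
  exact: Il (mem_msupp_mulX _ wl).
Qed.

End Step.

Lemma elimination_koszul0 A : dominated_elimination A -> koszul0 m (I A).
Proof.
elim=> {A} [A noe|A a b aA bA ab dom _ IH1 _ IH2].
  (* Without edges the empty set is a cover, so the ideal is the whole ring. *)
  rewrite (@ideal_eq _ (I A) (unit_ideal _)); first exact: koszul0_unit.
  move=> f; split=> // _ w _; apply/covered0; exists set0.
    by apply/coversP => x y xA yA; rewrite (negPf (noe x y xA yA)).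
  by rewrite /depolarize big_set0; apply/mnm_lepP => i; rewrite mnm0E.
exact: (koszul0_step aA bA ab dom).
Qed.

End Covers.

(** * Symbolic powers of cover ideals *)

Lemma mnm_mulSD n (a u w : 'X_{1..n}) d : (u <= w)%MM ->
  (a *+ d.+1 + w = (a + u) + (a *+ d + (w - u)))%MM.
Proof.
move=> le; rewrite -{1}(submK le).
by apply/mnmP => i; rewrite !(mnmDE, mulmnE); lia.
Qed.

Section SymbolicPowers.
Variables (K : fieldType) (H : sgraph).
Local Notation n := #|H|.
Local Notation J := (cover_ideal K H).
Implicit Types (w : 'X_{1..n}) (x y : H).

Definition edge_weight x y w := (w (enum_rank x) + w (enum_rank y))%N.

Lemma edge_weightD x y :
  {morph edge_weight x y : u w / (u + w)%MM >-> (u + w)%N}.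
Proof. by move=> u w; rewrite /edge_weight !mnmDE addnACA. Qed.

(** The [d]-th power of the prime generated by the variables of [x] and [y], when these are
    distinct. *)
Definition edge_ideal_pow x y d : ideal (vertex_ring K H) :=
  wt_ideal K (edge_weightD x y) d.

Definition heavy_on_edges d w := forall x y, x -- y -> (d <= edge_weight x y w)%N.

Lemma heavy_on_edges_up d (u w : 'X_{1..n}) :
  heavy_on_edges d w -> heavy_on_edges d (u + w)%MM.
Proof. by move=> h x y /h; rewrite edge_weightD; lia. Qed.

(** The intersection of the ideals [edge_ideal_pow x y d] over all edges. *)
Definition heavy_ideal d : ideal (vertex_ring K H) :=
  monomial_ideal K (@heavy_on_edges_up d).

Definition indicator (W : {set H}) : 'X_{1..n} :=
  [multinom (enum_val i \in W : nat) | i < n].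

Lemma indicatorE W x : indicator W (enum_rank x) = (x \in W).
Proof. by rewrite mnmE enum_rankK. Qed.

Lemma prod_vertex_var (W : {set H}) :
  \prod_(x in W) vertex_var K x = ('X_[indicator W] : {mpoly K[n]}).
Proof.
rewrite -(big_morph (@mpolyX n K) (@mpolyXD n K) (mpolyX0 n K)).
congr mpolyX; apply/mnmP => i; rewrite -(enum_valK i) indicatorE mnm_sumE.
under eq_bigr do rewrite mnm1E (inj_eq enum_rank_inj).
have [xW|xW] := boolP (enum_val i \in W).
  rewrite (bigD1 (enum_val i)) //= eqxx big1 // => z.
  by case/andP => _ /negPf ->.
by rewrite big1 // => z zW; case: eqVneq zW xW => [->|//] ->.
Qed.

Lemma cover_idealP f : J f <-> heavy_ideal 1 f.
Proof.
split=> [|hf].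
  apply: ideal_gen_sub => _ [W [cW ->]]; rewrite prod_vertex_var.
  apply/monomial_idealX => x y xy; rewrite /edge_weight !indicatorE.
  move/forallP: cW => /(_ x)/forallP/(_ y); rewrite xy /=.
  by case/orP => ->; rewrite ?addn1.
apply: mpoly_ideal => w /hf hw.
pose W := [set x | w (enum_rank x) != 0%N].
have le : (indicator W <= w)%MM.
  apply: mnm_lep_enum_rank => x; rewrite indicatorE inE.
  by case: (w _).
rewrite -(submK le) mpolyXD; apply: idealMl.
rewrite -prod_vertex_var; apply: ideal_gen_in; exists W; split=> //.
apply/forallP => x; apply/forallP => y; apply/implyP => /hw.
by rewrite /edge_weight !inE; lia.
Qed.

Lemma edge_ideal_proper x y : ~ edge_ideal_pow x y 1 1.
Proof.
move=> h; have := h 0%MM; rewrite msupp1 inE eqxx => /(_ isT).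
by rewrite /edge_weight !mnm0E.
Qed.

Lemma edge_ideal_prime x y : prime_ideal (edge_ideal_pow x y 1).
Proof.
split=> [|f g fg]; first exact: edge_ideal_proper.
have [|Nf] := pselect (edge_ideal_pow x y 1 f); first by left.
by right; apply: wt_ideal_primary fg Nf.
Qed.

Lemma cover_ideal_pow_edge x y d f :
  x -- y -> ideal_pow J d f -> edge_ideal_pow x y d f.
Proof.
move=> xy; elim: d f => [//|d IH] f.
apply: ideal_gen_sub => _ [b [c [/cover_idealP hb /IH hc ->]]].
move=> w /msupp_mul [w1 [w2 [/hb /(_ x y xy) h1 /hc h2 ->]]].
by rewrite edge_weightD; lia.
Qed.

(** The product of all variables but those of [x] and [y]. Every edge other than that between [x]
    and [y] meets it, so the annihilator of its class modulo [J] is the prime of that edge; it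
    becomes invertible in the localization there. *)
Definition away x y : 'X_{1..n} := indicator (~: [set x; y]).

Lemma away_weight x y : edge_weight x y (away x y) = 0%N.
Proof. by rewrite /edge_weight !indicatorE !inE !eqxx orbT. Qed.

Lemma away_heavy x y w : x -- y ->
  heavy_on_edges 1 (away x y + w)%MM <-> (1 <= edge_weight x y w)%N.
Proof.
move=> xy; split=> [/(_ x y xy)|h x' y' xy']; first by rewrite edge_weightD away_weight.
rewrite edge_weightD; have [/eqP|] := posnP (edge_weight x' y' (away x y)); last by lia.
rewrite /edge_weight !indicatorE addn_eq0 !eqb0 !inE !negbK.
move=> /andP [/orP [/eqP ex'|/eqP ex'] /orP [/eqP ey'|/eqP ey']];
  move: xy' h; rewrite ex' ey' ?sedge_irrefl // /edge_weight => _; lia.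
Qed.

Lemma edge_ideal_associated x y :
  x -- y -> associated_prime J (edge_ideal_pow x y 1).
Proof.
move=> xy; split; first exact: edge_ideal_prime.
exists ('X_[away x y] : {mpoly K[n]}) => f; rewrite cover_idealP mulrC.
split=> [hf|hf w wf].
  by apply: monomial_ideal_mulX hf => w; apply: (away_heavy _ xy).2.
by apply/(away_heavy w xy)/hf/mem_msupp_mulX.
Qed.

(** Each factor [away x y] combines with one variable of [x] or [y] taken from [w] into a generator
    of [J]. *)
Lemma away_pow x y d w : x -- y -> (d <= edge_weight x y w)%N ->
  ideal_pow J d ('X_[away x y *+ d + w] : {mpoly K[n]}).
Proof.
move=> xy; elim: d w => [//|d IH] w le.
have [z [zxy wz]] : exists z, z \in [set x; y] /\ w (enum_rank z) != 0%N.
  have [wx|wx] := eqVneq (w (enum_rank x)) 0%N; last by exists x; rewrite !inE eqxx.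
  exists y; rewrite !inE eqxx orbT; split=> //.
  by rewrite -lt0n; move: le; rewrite /edge_weight wx add0n; apply: leq_trans.
have lez : (U_(enum_rank z) <= w)%MM by rewrite lep1mP.
have -> : (away x y *+ d.+1 + w =
    (away x y + U_(enum_rank z)) + (away x y *+ d + (w - U_(enum_rank z))))%MM.
  exact: mnm_mulSD.
have wz1 : edge_weight x y U_(enum_rank z) = 1%N.
  rewrite /edge_weight !mnm1E !(inj_eq enum_rank_inj).
  move: zxy; rewrite !inE => /orP [] /eqP ->; rewrite eqxx.
    by case: eqVneq xy => [->|//]; rewrite sedge_irrefl.
  by case: eqVneq xy => [->|//]; rewrite sedge_irrefl.
rewrite mpolyXD; apply: ideal_mul_in.
  by apply/cover_idealP/monomial_idealX/(away_heavy _ xy); rewrite wz1.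
apply: IH; have := edge_weightD x y (w - U_(enum_rank z))%MM U_(enum_rank z)%MM.
by rewrite submK //; lia.
Qed.

(** Localizing at the prime of an edge gives one inclusion, by primariness. Conversely every
    associated prime lies in the prime of some edge, where a power of [away] serves as
    denominator. *)
Lemma symbolic_powerP d f : symbolic_power J d f <-> heavy_ideal d f.
Proof.
split=> [Jf w wf x y xy|hf p ap].
  have [s [g [t [Ns Nt Jg e]]]] := Jf _ (edge_ideal_associated xy).
  have : edge_ideal_pow x y d (t * (s * f)).
    by rewrite e; apply/idealMl/cover_ideal_pow_edge.
  by move=> /wt_ideal_primary /(_ Nt) /wt_ideal_primary /(_ Ns); apply.
have [[p1 _] [f0 pf0]] := ap.
(* The prime [p] is proper, so [f0] is not in [J] and some edge ideal misses it. *)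
have [x [y [xy Nf0]]] : exists x y, x -- y /\ ~ edge_ideal_pow x y 1 f0.
  have [//|H0] := pselect (exists x y, x -- y /\ ~ edge_ideal_pow x y 1 f0).
  case: p1; apply/pf0; rewrite mul1r; apply/cover_idealP => w wf0 x y xy.
  have [|N] := pselect (edge_ideal_pow x y 1 f0); first by apply.
  by case: H0; exists x, y.
have sub g : p g -> edge_ideal_pow x y 1 g.
  move=> /pf0 /cover_idealP h; apply: wt_ideal_primary (Nf0) => w.
  by rewrite mulrC => /h /(_ x y xy).
pose s : vertex_ring K H := 'X_[away x y *+ d].
exists s, (s * f), 1; split=> //.
  move=> /sub /monomial_idealX.
  by rewrite /edge_weight !mulmnE; have := away_weight x y; rewrite /edge_weight; lia.
apply: (@mpoly_ideal K n) => w /msupp_mul [w1 [w2 [+ w2f ->]]].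
rewrite msuppX inE => /eqP ->; apply: away_pow (xy) _.
exact: hf.
Qed.

(** * Symbolic powers as depolarized cover ideals *)

Section Depolarization.
Variable k : nat.
Local Notation Hk := (duplication_const H k).

Let copies_of (W : {set Hk}) x : seq nat :=
  [seq nat_of_ord (tagged z) | z <- enum [set z in W | tag z == x]].

Let size_copies_of W x :
  size (copies_of W x) = depolarize W (enum_rank x).
Proof. by rewrite size_map -cardE depolarizeE. Qed.

Let mem_copies_of (W : {set Hk}) (z : Hk) :
  z \in W -> nat_of_ord (tagged z) \in copies_of W (tag z).
Proof. by move=> zW; apply/map_f; rewrite mem_enum inE zW eqxx. Qed.

Let copies_of_uniq W x : uniq (copies_of W x).
Proof.
rewrite map_inj_in_uniq ?enum_uniq // => z z'.
rewrite !mem_enum !inE => /andP [_ /eqP <-] /andP [_ /eqP].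
case: z z' => v r [v' r'] /= /esym ev; case: v' / ev r' => r' e.
by congr Tagged; apply: val_inj.
Qed.

Lemma heavy_covered w :
  heavy_on_edges k w <-> covered [set: Hk] 0 w.
Proof.
rewrite covered0; split=> [hw|[W /coversP cW dW] x y xy].
  (* The lowest copies of each vertex, as many as its exponent allows: indices of adjacent copies
     add up to less than [k], so one of them lies in [W]. *)
  pose W : {set Hk} := [set z : Hk | (tagged z < w (enum_rank (tag z)))%N].
  exists W.
    apply/coversP => z z' _ _ /andP [zz' lt]; rewrite !inE.
    by have := hw _ _ zz'; rewrite /edge_weight; lia.
  apply: mnm_lep_enum_rank => x; rewrite -size_copies_of -[X in (_ <= X)%N](size_iota 0).
  apply: uniq_leq_size => // i /mapP [z]; rewrite mem_enum !inE.
  by move=> /andP [lt /eqP <-] ->; rewrite mem_iota.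
apply: (@leq_trans (edge_weight x y (depolarize W))); last first.
  by rewrite /edge_weight leq_add //; apply/mnm_lepP.
rewrite /edge_weight -!size_copies_of -{1}(size_iota 0 k).
(* The [k] edges from copy [i] of [x] to copy [k.-1 - i] of [y] are disjoint, and [W] meets each;
   reflecting the indices at [y] turns this into a covering of the [i < k]. *)
rewrite -(size_map (fun i => k.-1 - i)%N (copies_of W y)) -size_cat.
apply: uniq_leq_size (iota_uniq _ _) _ => i; rewrite mem_iota add0n mem_cat => /= lt_i.
have ix : (i < copies (fun=> k) x)%N by rewrite (copies_edge _ xy).
have iy : (k.-1 - i < copies (fun=> k) y)%N.
  by rewrite (@copies_edge _ _ y x) 1?sedge_sym //; lia.
pose a : Hk := Tagged (fun x => 'I_(copies (fun=> k) x)) (Ordinal ix).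
pose b : Hk := Tagged (fun x => 'I_(copies (fun=> k) x)) (Ordinal iy).
have ab : a -- b by rewrite /= /dup_edge /= xy /=; lia.
have /orP [/mem_copies_of -> //|/mem_copies_of iW] := cW a b (in_setT _) (in_setT _) ab.
apply/orP; right; apply/mapP; exists (k.-1 - i)%N => //; lia.
Qed.

Lemma symbolic_power_partial_cover f :
  symbolic_power J k f <-> partial_cover_ideal K [set: Hk] f.
Proof.
rewrite symbolic_powerP; split=> h w /h; first by move/heavy_covered.
by move=> ?; apply/heavy_covered.
Qed.

End Depolarization.

End SymbolicPowers.

Local Close Scope ring_scope.

Theorem theorem4p6 (K : fieldType)
    (K_infinite : forall s : seq K, exists a : K, a \notin s)
    (G : sgraph) (S : {set G}) (S_cover : cycle_cover S)
    (C : {x : G | x \in S} -> sgraph) (c : forall s, C s)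
    (C_star : forall s, star_complete (c s))
    (C_non_pure : forall s, non_pure (C s)) :
  let H := attach c in
  (forall k : nat, 1 <= k -> vertex_decomposable (duplication_const H k)) /\
  (forall k : nat, 1 <= k ->
     koszul (irrelevant_ideal K H) (symbolic_power (cover_ideal K H) k)).
Proof.
move=> H; split=> k _; first exact: attach_vertex_decomposable.
have -> : symbolic_power (cover_ideal K H) k =
    partial_cover_ideal K [set: duplication_const H k].
  by apply: ideal_eq => f; apply: symbolic_power_partial_cover.
(* The elimination that gives vertex decomposability also builds the resolution. *)
apply/koszul0_koszul/elimination_koszul0.
exact: attach_elimination.
Qed.
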